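(* Let $\phi=\tilde p/p$ be an irreducible rational inner function on $\mathbb{D}^3$ of degree $(m,n,1)$ with $p(z)=p_1(z_1,z_2)+z_3p_2(z_1,z_2)$, $\tilde p(z)=z_3\tilde p_1(z_1,z_2)+\tilde p_2(z_1,z_2)$. Fix $\lambda\in\mathbb{T}$, let $q_\lambda=\lambda p_1-\tilde p_2$, and let $\Psi_\lambda=\bar\lambda\,q_\lambda/\tilde q_\lambda$. Let $\mathcal{C}_\lambda=\overline{\{\zeta\in\mathbb{T}^3\setminus\mathcal{Z}_p:\phi(\zeta)=\lambda\}}$. Then: (i) $(\mathcal{Z}_{q_\lambda}\cap\mathbb{T}^2)\times\mathbb{T}\subseteq\mathcal{C}_\lambda$; (ii) $1/\Psi_\lambda$ is a two-variable rational inner function, and $\mathcal{C}_\lambda\setminus\big((\mathcal{Z}_{q_\lambda}\cap\mathbb{T}^2)\times\mathbb{T}\big)$ is parameterized by $\tau_3=\Psi_\lambda(\tau_1,\tau_2)=\bar\lambda\frac{q_\lambda(\tau_1,\tau_2)}{\tilde q_\lambda(\tau_1,\tau_2)}$ for $(\tau_1,\tau_2)\in\mathbb{T}^2$.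
   Context: A rational inner function (RIF) on $\mathbb{D}^d$ is a rational function holomorphic on the polydisk with unimodular radial limits a.e. on $\mathbb{T}^d$; a three-variable RIF is written $\phi=\tilde p/p$ with $p$ zero-free on $\mathbb{D}^3$ and $p,\tilde p$ without common factors. For degree $(m,n,1)$, $\tilde p(z)=z_1^mz_2^nz_3\overline{p(1/\bar z_1,1/\bar z_2,1/\bar z_3)}$, and for any $q\in\mathbb{C}[z_1,z_2]$ the reflection is taken with respect to $(m,n)$: $\tilde q(z_1,z_2)=z_1^mz_2^n\overline{q(1/\bar z_1,1/\bar z_2)}$ (so $\tilde p_j$ are the reflections of $p_j$). $\mathcal{Z}_q$ denotes the zero set of $q$. *)

(* Defs.v *)
From HB Require Import structures.
From mathcomp Require Import all_boot all_order all_algebra.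
From mathcomp Require Import complex.
From mathcomp Require Import all_classical all_reals all_analysis.
Set Implicit Arguments. Unset Strict Implicit. Unset Printing Implicit Defensive.
Import Order.TTheory GRing.Theory Num.Theory.
Local Open Scope ring_scope.

Section Defs.
Variable R : realType.
Local Notation C := (R[i]).

Definition ev2 (m n : nat) (P : 'M[C]_(m.+1, n.+1)) (z1 z2 : C) : C :=
  \sum_(i < m.+1) \sum_(j < n.+1) P i j * z1 ^+ i * z2 ^+ j.

(* Reflection with respect to (m,n):
   refl P (z1,z2) = z1^m z2^n conj(P(1/conj z1, 1/conj z2)), coefficientwise. *)
Definition refl (m n : nat) (P : 'M[C]_(m.+1, n.+1)) : 'M[C]_(m.+1, n.+1) :=
  \matrix_(i, j) (P (rev_ord i) (rev_ord j))^*.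

Definition onT (z : C) : Prop := `|z| = 1.
Definition inD (z : C) : Prop := `|z| < 1.

Definition is_poly3 (f : C -> C -> C -> C) : Prop :=
  exists (N : nat) (c : nat -> nat -> nat -> C), forall z1 z2 z3 : C,
    f z1 z2 z3 = \sum_(i < N) \sum_(j < N) \sum_(k < N)
                   c i j k * z1 ^+ i * z2 ^+ j * z3 ^+ k.

Definition is_const3 (f : C -> C -> C -> C) : Prop :=
  exists c : C, forall z1 z2 z3, f z1 z2 z3 = c.

Definition common_factor3 (f g : C -> C -> C -> C) : Prop :=
  exists r s1 s2 : C -> C -> C -> C,
    [/\ is_poly3 r, is_poly3 s1, is_poly3 s2, ~ is_const3 r &
      forall z1 z2 z3, f z1 z2 z3 = r z1 z2 z3 * s1 z1 z2 z3 /\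
                       g z1 z2 z3 = r z1 z2 z3 * s2 z1 z2 z3].

Definition irreducible3 (f : C -> C -> C -> C) : Prop :=
  is_poly3 f /\ ~ is_const3 f /\
  forall a b : C -> C -> C -> C, is_poly3 a -> is_poly3 b ->
    (forall z1 z2 z3, f z1 z2 z3 = a z1 z2 z3 * b z1 z2 z3) ->
    is_const3 a \/ is_const3 b.

Definition cdiff (f : C -> C) (a : C) : Prop :=
  exists L : C, forall eps : R, 0 < eps -> exists delta : R, 0 < delta /\
    forall h : C, h != 0 -> `|h| < (delta%:C)%C ->
      `|(f (a + h) - f a) / h - L| < (eps%:C)%C.

(* holomorphic on the open bidisk D^2 (separately holomorphic, which is
   equivalent to holomorphic by Hartogs' theorem) *)
Definition holo_D2 (g : C -> C -> C) : Prop :=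
  (forall z1 z2, inD z1 -> inD z2 -> cdiff (fun w => g w z2) z1) /\
  (forall z1 z2, inD z1 -> inD z2 -> cdiff (fun w => g z1 w) z2).

Definition expi (t : R) : C := (cos t +i* sin t)%C.

Definition unimod_radial_limit (g : C -> C -> C) (t1 t2 : C) : Prop :=
  exists L : C, onT L /\ forall eps : R, 0 < eps -> exists delta : R, 0 < delta /\
    forall r : R, 0 <= r -> 1 - delta < r -> r < 1 ->
      `|g ((r%:C)%C * t1) ((r%:C)%C * t2) - L| < (eps%:C)%C.

Definition RIF2 (N D : C -> C -> C) : Prop :=
  (exists z1 z2, D z1 z2 != 0) /\
  exists g : C -> C -> C,
    [/\ holo_D2 g,
        (forall z1 z2, inD z1 -> inD z2 -> D z1 z2 != 0 -> g z1 z2 = N z1 z2 / D z1 z2) &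
        ((@lebesgue_measure R) \x (@lebesgue_measure R))%E.-negligible
          [set t : R * R | ~ unimod_radial_limit g (expi t.1) (expi t.2)]].

(* The three-variable polynomial p = p1(z1,z2) + z3 p2(z1,z2) and its
   reflection with respect to (m,n,1):
   ptilde = z1^m z2^n z3 conj(p(1/conj z)) = z3 refl(p1) + refl(p2). *)
Definition peval (m n : nat) (P1 P2 : 'M[C]_(m.+1, n.+1)) (z1 z2 z3 : C) : C :=
  ev2 P1 z1 z2 + z3 * ev2 P2 z1 z2.
Definition ptilde (m n : nat) (P1 P2 : 'M[C]_(m.+1, n.+1)) (z1 z2 z3 : C) : C :=
  z3 * ev2 (refl P1) z1 z2 + ev2 (refl P2) z1 z2.

(* ptilde has degree exactly (m,n,1) (so phi = ptilde/p has degree (m,n,1)) *)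
Definition ptilde_degree (m n : nat) (P1 P2 : 'M[C]_(m.+1, n.+1)) : Prop :=
  [/\ exists j, refl P1 ord_max j != 0 \/ refl P2 ord_max j != 0,
      exists i, refl P1 i ord_max != 0 \/ refl P2 i ord_max != 0 &
      refl P1 != 0].

Definition level_closure (m n : nat) (P1 P2 : 'M[C]_(m.+1, n.+1)) (lam : C)
    (z1 z2 z3 : C) : Prop :=
  forall eps : R, 0 < eps -> exists w1 w2 w3 : C,
    [/\ onT w1 /\ onT w2 /\ onT w3,
        peval P1 P2 w1 w2 w3 != 0,
        ptilde P1 P2 w1 w2 w3 / peval P1 P2 w1 w2 w3 = lam &
        `|z1 - w1| < (eps%:C)%C /\ `|z2 - w2| < (eps%:C)%C /\ `|z3 - w3| < (eps%:C)%C].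

End Defs.

(* Main.v *)
(** On the torus [ptilde = lam p] reads [t3 lam q~ = q], where [q~] has the modulus
    of [q]; so off the zeros of [q] the level set lies on the graph of Psi, and the
    two points to settle are that [q] has no zero in the bidisk and that every torus
    zero of [ptilde - lam p] is a limit of level points.

    Along a curve [w |-> (s1 w^a, s2 w^b, s3 w^c)] with unimodular [s_i] the quotient
    [ptilde / p] is a finite Blaschke product, which is elementary by factoring
    one-variable polynomials.  These curves are dense in the polydisk, so
    [|ptilde| <= |p|] there, with a Schwarz lemma when [ptilde] vanishes at the
    origin; composing with a disk automorphism makes the inequality strict, hence
    [q] is zero-free.  The radial limits of [1 / Psi] are those of finite Blaschke
    products, so they exist and are unimodular at every point of the torus.

    For the closure, let [ptilde = lam p] at a torus point [t].  For [s] near [t] on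
    the torus, the slice [w |-> (ptilde - lam p)(s w)] has a root near [1], which is
    on the circle by the Blaschke property.  Since [p] and [ptilde] are coprime,
    [p1 p1~ - p2 p2~] is a nonzero polynomial and [p1], [p2] have finitely many
    common zeros on the torus, so for generic [s] the polynomial [p] does not vanish
    at that root. *)
Require Import Defs.
From HB Require Import structures.
From mathcomp Require Import all_boot all_order all_algebra.
From mathcomp Require Import complex polyXY.
From mathcomp Require Import all_classical all_reals all_analysis.
From mathcomp Require Import ring lra.
Set Implicit Arguments. Unset Strict Implicit. Unset Printing Implicit Defensive.
Import Order.TTheory GRing.Theory Num.Theory.
Import numFieldNormedType.Exports.
Local Open Scope ring_scope.

(** * Reflections of one-variable polynomials *)

Section Circle.
Variable C : numClosedFieldType.
Implicit Types (x y z w t : C) (f g : {poly C}).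

Lemma conj_circle w : `|w| = 1 -> w^* = w^-1.
Proof.
move=> w1; have w0 : w != 0 by rewrite -normr_eq0 w1 oner_eq0.
by apply: (mulfI w0); rewrite -normCK w1 expr1n divff.
Qed.

Lemma conj_invconj w : ((w^*)^-1)^* = w^-1.
Proof. by rewrite fmorphV; congr (_^-1); apply: conjCK. Qed.

(** Cayley transforms of distinct small reals give arbitrarily many circle points near [t], and [f]
    has only finitely many roots. *)
Lemma poly_neq0_near f t d : f != 0 -> `|t| = 1 -> 0 < d ->
  exists s, [/\ `|s| = 1, `|s - t| < d & f.[s] != 0].
Proof.
move=> f0 t1 d0.
(* The [+ 3] gives [2 * x k < d], and [2 * x k] bounds the distance from [s k] to [t]. *)
pose x (k : nat) : C := d / (k + 3)%:R.
have xr k : (x k)^* = x k.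
  by apply/eqP; rewrite -CrealE ger0_real // divr_ge0 ?ler0n // ltW.
have x0 k : 0 < x k by rewrite divr_gt0 // ltr0n addn3.
have den k : 1 <= `|1 - 'i * x k|.
  rewrite -(@ler_pXn2r _ 2) ?nnegrE ?normr_ge0 ?ler01 // expr1n normCK.
  rewrite rmorphB rmorphM /= rmorph1 conjCi xr.
  have -> : (1 - 'i * x k) * (1 - - 'i * x k) = 1 - 'i ^+ 2 * x k ^+ 2 by ring.
  by rewrite sqrCi mulN1r opprK lerDl exprn_ge0 // ltW.
have den0 k : 1 - 'i * x k != 0 by rewrite -normr_gt0 (lt_le_trans ltr01).
pose s k := t * ((1 + 'i * x k) / (1 - 'i * x k)).
have s1 k : `|s k| = 1.
  rewrite normrM t1 mul1r normf_div.
  have -> : 1 + 'i * x k = (1 - 'i * x k)^*.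
    by rewrite rmorphB rmorphM /= rmorph1 conjCi xr mulNr opprK.
  by rewrite norm_conjC divff // normr_eq0.
have st k : `|s k - t| < d.
  have -> : s k - t = t * (2 * 'i * x k / (1 - 'i * x k)) by rewrite /s; field.
  rewrite normrM t1 mul1r normf_div ltr_pdivrMr ?normr_gt0 //.
  apply: (lt_le_trans _ (ler_peMr (ltW d0) (den k))).
  rewrite normrM (gtr0_norm (x0 k)) normrM normCi mulr1 ger0_norm ?ler0n //.
  rewrite /x mulrA ltr_pdivrMr ?ltr0n ?addn3 // mulrC ltr_pM2l //.
  by rewrite ltr_nat.
have t0 : t != 0 by rewrite -normr_eq0 t1 oner_eq0.
have sinj : injective s.
  move=> i j /(mulfI t0) /eqP.
  rewrite eqr_div ?den0 // => /eqP e.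
  have : x i = x j.
    apply: (mulfI (_ : 2 * 'i != 0)).
      by rewrite mulf_neq0 ?pnatr_eq0 // neq0Ci.
    apply/eqP; rewrite -subr_eq0.
    have -> : 2 * 'i * x i - 2 * 'i * x j =
      (1 + 'i * x i) * (1 - 'i * x j) - (1 + 'i * x j) * (1 - 'i * x i) by ring.
    by rewrite e subrr.
  rewrite /x => /(mulfI (lt0r_neq0 d0)) /invr_inj /eqP.
  by rewrite eqr_nat eqn_add2r => /eqP.
have [/allP a|/allPn [y /mapP [k _ ->] nk]] :=
  boolP (all (root f) [seq s k | k <- iota 0 (size f)]).
  have := max_poly_roots f0 (introT allP a).
  rewrite map_inj_uniq // iota_uniq => /(_ isT).
  by rewrite size_map size_iota ltnn.
by exists (s k); split.
Qed.

Lemma poly_eq_off0 f g : (forall w, w != 0 -> f.[w] = g.[w]) -> f = g.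
Proof.
move=> e; apply/eqP; rewrite -subr_eq0; apply/negPn/negP => n.
have [s [s1 _]] := poly_neq0_near n (normr1 C) ltr01.
have s0 : s != 0 by rewrite -normr_eq0 s1 oner_eq0.
by rewrite hornerD hornerN e // subrr eqxx.
Qed.

Lemma normB_reflE a w :
  `|w - a| ^+ 2 - `|1 - a^* * w| ^+ 2 = (`|a| ^+ 2 - 1) * (1 - `|w| ^+ 2).
Proof.
rewrite !normCK !rmorphB !rmorphM /= rmorph1 conjCK; ring.
Qed.

Lemma norm_refl_factor_lt a w : 1 < `|a| -> `|w| < 1 ->
  `|1 - a^* * w| < `|w - a|.
Proof.
move=> a1 w1.
rewrite -(@ltr_pXn2r _ 2) ?nnegrE ?normr_ge0 // -subr_gt0 normB_reflE.
by rewrite mulr_gt0 // subr_gt0 ?expr_gt1 // expr_lt1.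
Qed.

(** One-variable reflection of degree [N], up to the constant [k]. The point 0 is excluded, since
    its inverse is 0 by convention; by [poly_eq_off0] the remaining points still determine [g]. *)
Definition reflects (k : C) (N : nat) f g :=
  forall w, w != 0 -> g.[w] = k * w ^+ N * (f.[(w^*)^-1])^*.

(** Reflection sends each factor [w - a] to [1 - a^* * w]; the deficit [N - size rs] in degree
    becomes a power of ['X]. *)
Lemma reflects_factor k N f g : f != 0 -> (size f <= N.+1)%N ->
  reflects k N f g -> exists rs : seq C,
  [/\ (size rs <= N)%N,
      f = lead_coef f *: \prod_(a <- rs) ('X - a%:P) &
      g = (k * (lead_coef f)^*) *: ('X^(N - size rs) *
            \prod_(a <- rs) (1 - a^* *: 'X))].
Proof.
move=> f0 sf fg; have [rs frs] := closed_field_poly_normal f.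
exists rs.
have srs : (size rs <= N)%N.
  by move: sf; rewrite frs size_scale ?lead_coef_eq0 // size_prod_XsubC.
split=> //; apply: poly_eq_off0 => w w0.
rewrite fg // {1}frs !hornerE !horner_prod.
rewrite rmorphM /= rmorph_prod /= -!mulrA; congr (_ * _).
rewrite mulrCA; congr (_ * _).
rewrite -{1}(subnK srs) exprD -mulrA; congr (_ * _).
have -> : w ^+ size rs = \prod_(a <- rs) w.
  by rewrite big_const_seq count_predT iter_mulr_1.
rewrite -big_split /=.
apply: eq_bigr => a _; rewrite !hornerE rmorphB /= conj_invconj.
by rewrite mulrBr divff // mulrC.
Qed.

Lemma circle_refl_factor a w : `|a| = 1 -> 1 - a^* * w = (- a^*) * (w - a).
Proof.
move=> a1.
by rewrite mulrBr !mulNr opprK [a^* * a]mulrC -normCK a1 expr1n addrC.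
Qed.

(** Each root on the circle contributes only the unimodular constant [- a^*], whereas one root
    outside the closed disk already makes the inequality strict. *)
Lemma refl_prod_dichotomy (rs : seq C) : (forall a, a \in rs -> 1 <= `|a|) ->
  (exists2 mu, `|mu| = 1 & forall w,
     \prod_(a <- rs) (1 - a^* * w) = mu * \prod_(a <- rs) (w - a)) \/
  (forall w, `|w| < 1 ->
     `|\prod_(a <- rs) (1 - a^* * w)| < `|\prod_(a <- rs) (w - a)|).
Proof.
elim: rs => [_|a rs IH H].
  by left; exists 1 => [|w]; rewrite ?normr1 // !big_nil mulr1.
have a1 : 1 <= `|a| by apply: H; rewrite inE eqxx.
have {}IH := IH (fun b hb => H b (@mem_behead _ (a :: rs) b hb)).
have nza b w : 1 <= `|b| -> `|w| < 1 -> `|w - b| > 0.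
  move=> b1 w1; rewrite normr_gt0 subr_eq0; apply/eqP => e.
  by have := lt_le_trans w1 b1; rewrite e ltxx.
have nz w : `|w| < 1 -> `|\prod_(b <- rs) (w - b)| > 0.
  move=> w1; rewrite normr_prod big_seq prodr_gt0 // => b hb.
  by apply: nza => //; apply: H; rewrite inE hb orbT.
have [a_1|a_gt1] := eqVneq `|a| 1; last first.
  have {}a1 : 1 < `|a| by rewrite lt_neqAle eq_sym a_gt1.
  right=> w w1; rewrite !big_cons !normrM.
  have le : `|\prod_(b <- rs) (1 - b^* * w)| <= `|\prod_(b <- rs) (w - b)|.
    case: IH => [[mu mu1 ->]|/(_ w w1) /ltW //].
    by rewrite normrM mu1 mul1r.
  apply: (le_lt_trans (ler_wpM2l (normr_ge0 _) le)).
  by rewrite ltr_pM2r ?nz // norm_refl_factor_lt.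
case: IH => [[mu mu1 IH]|IH].
  left; exists (- a^* * mu) => [|w].
    by rewrite normrM normrN norm_conjC a_1 mu1 mulr1.
  by rewrite !big_cons IH circle_refl_factor //; ring.
right=> w w1; rewrite !big_cons circle_refl_factor // !normrM.
by rewrite normrN norm_conjC a_1 mul1r ltr_pM2l ?nza ?IH.
Qed.

Lemma reflects_roots k N f g : f != 0 -> (size f <= N.+1)%N ->
  reflects k N f g -> (forall w, `|w| < 1 -> f.[w] != 0) ->
  exists rs : seq C, [/\ (size rs <= N)%N,
    forall a, a \in rs -> 1 <= `|a|,
    forall w, f.[w] = lead_coef f * \prod_(a <- rs) (w - a) &
    forall w, g.[w] = k * (lead_coef f)^* *
      (w ^+ (N - size rs) * \prod_(a <- rs) (1 - a^* * w))].
Proof.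
move=> f0 sf fg fD; have [rs [srs frs grs]] := reflects_factor f0 sf fg.
have fE w : f.[w] = lead_coef f * \prod_(a <- rs) (w - a).
  by rewrite {1}frs !hornerE horner_prod; under eq_bigr do rewrite !hornerE.
exists rs; split=> // [a ars|w].
  have [//|/fD] := real_leP (real1 C) (normr_real a).
  by rewrite fE (big_rem a) //= subrr mul0r mulr0 eqxx.
by rewrite grs !hornerE horner_prod; under eq_bigr do rewrite !hornerE.
Qed.

(** A maximum principle for [g / f]: besides a root outside the closed disk, a positive degree
    deficit also gives strictness, through the factor [w ^+ (N - size rs)]. *)
Lemma reflects_dichotomy k N f g : f != 0 -> (size f <= N.+1)%N ->
  reflects k N f g -> (forall w, `|w| < 1 -> f.[w] != 0) -> `|k| = 1 ->
  (exists2 mu, `|mu| = 1 & forall w, g.[w] = mu * f.[w]) \/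
  (forall w, `|w| < 1 -> `|g.[w]| < `|f.[w]|).
Proof.
move=> f0 sf fg fD k1; have [rs [srs rs1 fE gE]] := reflects_roots f0 sf fg fD.
have lc0 : lead_coef f != 0 by rewrite lead_coef_eq0.
have lcn : `|(lead_coef f)^*| = `|lead_coef f| by rewrite norm_conjC.
have lcp : 0 < `|lead_coef f| by rewrite normr_gt0.
have prodN w : `|w| < 1 -> 0 < `|\prod_(a <- rs) (w - a)|.
  by move=> /fD; rewrite fE mulf_eq0 negb_or normr_gt0 => /andP[].
have [[mu mu1 rsE]|lt] := refl_prod_dichotomy rs1; last first.
  right=> w w1; rewrite fE gE !normrM k1 lcn mul1r ltr_pM2l //.
  apply: le_lt_trans (lt w w1); rewrite normrX ler_piMl ?normr_ge0 //.
  by rewrite exprn_ile1 // ltW.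
have [e|] := posnP (N - size rs).
  left; exists (k * mu * (lead_coef f)^* / lead_coef f) => [|w].
    by rewrite normf_div !normrM k1 mu1 lcn !mul1r divff // lt0r_neq0.
  by rewrite fE gE e expr0 rsE; field.
move=> Npos; right=> w w1; rewrite fE gE !normrM k1 lcn mul1r ltr_pM2l //.
by rewrite rsE normrM mu1 mul1r gtr_pMl ?prodN // normrX exprn_ilt1 // -lt0n.
Qed.

(* Schwarz lemma for the finite Blaschke product [g / f]. *)
Lemma reflects_schwarz k N e f g h : f != 0 -> (size f <= N.+1)%N ->
  reflects k N f g -> (forall w, `|w| < 1 -> f.[w] != 0) -> `|k| = 1 ->
  g = 'X^e * h ->
  forall w, `|w| < 1 -> `|g.[w]| <= `|w| ^+ e * `|f.[w]|.
Proof.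
move=> f0 sf fg fD k1 gh w w1.
have [rs [srs rs1 fE gE]] := reflects_roots f0 sf fg fD.
have lc0 : lead_coef f != 0 by rewrite lead_coef_eq0.
have lcn : `|(lead_coef f)^*| = `|lead_coef f| by rewrite norm_conjC.
have k0 : k != 0 by rewrite -normr_eq0 k1 oner_eq0.
(* Each [1 - a^* * z] equals 1 at 0, so [g] vanishes at 0 to order exactly [N - size rs]. *)
have eN : (e <= N - size rs)%N.
  rewrite leqNgt; apply/negP => lt; set d := (N - size rs)%N in lt gE *.
  pose u := \prod_(a <- rs) (1 - a^* *: 'X) : {poly C}.
  have uE z : u.[z] = \prod_(a <- rs) (1 - a^* * z).
    by rewrite horner_prod; under eq_bigr do rewrite !hornerE.
  have E : 'X^(e - d) * h = (k * (lead_coef f)^*) *: u.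
    apply: poly_eq_off0 => z z0; apply: (mulfI (expf_neq0 d z0)).
    have := gE z; rewrite gh -{1}(subnKC (ltnW lt)) exprD -mulrA !hornerE.
    by rewrite uE => ->; congr (_ * _); rewrite -[RHS]mulrA [RHS]mulrC.
  have := congr1 (fun q => q.[0]) E.
  rewrite !hornerE uE expr0n subn_eq0 leqNgt lt /= mul0r big1; last first.
    by move=> a _; rewrite mulr0 subr0.
  by move/esym/eqP; rewrite mulr1 mulf_eq0 conjC_eq0 (negPf k0) (negPf lc0).
rewrite fE gE !normrM k1 lcn mul1r [leRHS]mulrCA ler_pM2l ?normr_gt0 //.
rewrite -(subnKC eN) exprD normrM normrX -mulrA ler_wpM2l ?exprn_ge0 //.
have le : `|\prod_(a <- rs) (1 - a^* * w)| <= `|\prod_(a <- rs) (w - a)|.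
  have [[mu mu1 ->]|/(_ w w1) /ltW //] := refl_prod_dichotomy rs1.
  by rewrite normrM mu1 mul1r.
apply: le_trans le; rewrite normrX ler_piMl ?normr_ge0 //.
by rewrite exprn_ile1 // ltW.
Qed.

Lemma reflects_conj_root k N f g l w : reflects k N f g -> `|k| = 1 ->
  `|l| = 1 -> w != 0 -> g.[w] = l * f.[w] ->
  g.[(w^*)^-1] = l * f.[(w^*)^-1].
Proof.
move=> fg k1 l1 w0 e; set u := (w^*)^-1.
have u0 : u != 0 by rewrite invr_eq0 conjC_eq0.
have k0 : k != 0 by rewrite -normr_eq0 k1 oner_eq0.
have l0 : l != 0 by rewrite -normr_eq0 l1 oner_eq0.
have ku : (u^*)^-1 = w by rewrite /u conj_invconj invrK.
have := fg w w0; rewrite e -/u => E; have -> : f.[u] = (l * f.[w] / (k * w ^+ N))^*.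
  by rewrite E mulrAC divff ?mul1r ?conjCK // mulf_neq0 // expf_neq0.
rewrite fg // ku !(rmorphM, fmorphV, rmorphXn) /= (conj_circle k1) (conj_circle l1).
rewrite /u exprVn; field.
by rewrite k0 l0 expf_neq0 ?conjC_eq0.
Qed.

(** A solution in the open disk excludes the strict case of [reflects_dichotomy]; a solution outside
    is first reflected into the disk. *)
Lemma reflects_root_circle k N f g l w : f != 0 -> (size f <= N.+1)%N ->
  reflects k N f g -> (forall w, `|w| < 1 -> f.[w] != 0) -> `|k| = 1 ->
  `|l| = 1 -> g.[w] = l * f.[w] ->
  `|w| = 1 \/ forall z, g.[z] = l * f.[z].
Proof.
move=> f0 sf fg fD k1 l1 e.
have inner z : `|z| < 1 -> g.[z] = l * f.[z] -> forall y, g.[y] = l * f.[y].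
  move=> z1 ez; have [[mu mu1 mE] y|/(_ z z1)] := reflects_dichotomy f0 sf fg fD k1.
    by rewrite mE -(mulIf (fD z z1) (etrans (esym (mE z)) ez)).
  by rewrite ez normrM l1 mul1r ltxx.
have [lt|gt|] := real_ltgtP (normr_real w) (real1 C); last by left.
  by right; apply: inner lt e.
have w0 : w != 0 by rewrite -normr_gt0 (lt_trans ltr01).
right; apply: (inner (w^*)^-1); last exact: reflects_conj_root fg k1 l1 w0 e.
by rewrite normfV norm_conjC invf_lt1 // (lt_trans ltr01).
Qed.

End Circle.

(** * Common factors in two variables *)

Section Bivariate.
Variable C : numClosedFieldType.
Implicit Types (a x y : C) (c : {poly C}) (f g h r u v : {poly {poly C}}).

(** In [{poly {poly C}}] the inner variable is read as x and the outer one as y, so this is the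
    restriction to the line x = a. *)
Definition fiber a f : {poly C} := map_poly (horner_eval a) f.

Lemma fiberE a f y : (fiber a f).[y] = f.[y%:P].[a].
Proof.
by rewrite -[RHS]/(horner_eval a _) -horner_map /= /horner_eval hornerC.
Qed.

Lemma fiberM a f g : fiber a (f * g) = fiber a f * fiber a g.
Proof. exact: rmorphM. Qed.

Lemma fiberC a c : fiber a c%:P = c.[a]%:P.
Proof. exact: map_polyC. Qed.

Lemma fiber_eq0 a f : fiber a f = 0 -> exists h, f = ('X - a%:P)%:P * h.
Proof.
move=> f0; exists (map_poly (fun c => c %/ ('X - a%:P)) f).
apply/polyP => i; rewrite coefCM coef_map_id0 ?div0p //.
rewrite mulrC divpK // dvdp_XsubCl rootE.
by have := congr1 (fun p : {poly C} => p`_i) f0; rewrite coef_map coef0 => /eqP.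
Qed.

Lemma polyC_XsubC_neq0 a : ('X - a%:P)%:P != 0 :> {poly {poly C}}.
Proof. by rewrite polyC_eq0 polyXsubC_eq0. Qed.

(* Gauss's lemma: a pair not divisible by any [x - a] is primitive over [C[x]]. *)
Lemma primitive_cancel c f g u v h :
  (forall a, ~ (fiber a f = 0 /\ fiber a g = 0)) -> c != 0 ->
  c%:P * u = h * f -> c%:P * v = h * g ->
  exists k, u = k * f /\ v = k * g.
Proof.
move=> prim; have [n] := ubnP (size c).
elim: n c h => // n IH c h /ltnSE sc c0 uE vE.
have [/size_poly1P[k k0 cE]|s1] := boolP (size c == 1).
  exists ((k^-1)%:P%:P * h); rewrite -!mulrA -uE -vE !mulrA cE -!polyCM.
  by rewrite mulVf // !mul1r.
have [a ra] : exists a, root c a.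
  by apply/closed_rootP.
have [c' cE] := factor_theorem _ _ ra.
have ca : c.[a] = 0 by apply/rootP.
(* On the line over the root [a] of [c] both [h * f] and [h * g] vanish while [f] and [g] do not
   both vanish, so [h] does and a factor ['X - a%:P] cancels. *)
have h0 : fiber a h = 0.
  have := congr1 (fiber a) vE; have := congr1 (fiber a) uE.
  rewrite !fiberM !fiberC ca !mul0r => /esym/eqP; rewrite mulf_eq0.
  case/orP=> [/eqP //|/eqP f0] /esym/eqP; rewrite mulf_eq0.
  case/orP=> [/eqP //|/eqP g0]; by case: (prim a).
have [h' hE] := fiber_eq0 h0.
have c'0 : c' != 0 by apply: contraNneq c0 => c'0; rewrite cE c'0 mul0r.
apply: (IH c' h') => //.
- by move: sc; rewrite cE size_Mmonic ?monicXsubC // size_XsubC addn2.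
- by apply: (mulfI (polyC_XsubC_neq0 a)); rewrite !mulrA -polyCM [_ * c']mulrC -cE -hE.
- by apply: (mulfI (polyC_XsubC_neq0 a)); rewrite !mulrA -polyCM [_ * c']mulrC -cE -hE.
Qed.

(** Splitting off a factor ['X - a%:P] lowers the degree of the leading coefficient, so the process
    stops. *)
Lemma primitive_part f : f != 0 -> exists c g,
  [/\ c != 0, f = c%:P * g & forall a, fiber a g <> 0].
Proof.
move=> f0; have [n] := ubnP (size (lead_coef f)).
elim: n f f0 => // n IH f f0 /ltnSE sf.
have [[a fa]|na] := pselect (exists a, fiber a f = 0); last first.
  by exists 1, f; split; rewrite ?oner_neq0 ?mul1r // => a fa; apply: na; exists a.
have [h hE] := fiber_eq0 fa.
have h0 : h != 0 by apply: contraNneq f0 => h0; rewrite hE h0 mulr0.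
have [|c [g [c0 gE prim]]] := IH h h0.
  move: sf; rewrite hE lead_coefM lead_coefC size_monicM ?monicXsubC ?lead_coef_eq0 //.
  by rewrite size_XsubC.
exists (('X - a%:P) * c), g; split => //; first by rewrite mulf_neq0 ?polyXsubC_eq0.
by rewrite hE gE polyCM mulrA.
Qed.

(** A nonzero resultant in y is a polynomial in x alone lying in the ideal. If it vanishes, the
    pseudo-gcd is nonconstant in y, and by Gauss's lemma its primitive part divides both
    polynomials. Polynomials constant in y are treated apart, because the resultant identity asks
    for both sizes above 1. *)
Lemma common_factor_or_ideal f g :
  (exists r u v, [/\ f = r * u, g = r * v & forall k, r <> k%:P%:P]) \/
  ((forall a, ~ (fiber a f = 0 /\ fiber a g = 0)) /\
   exists u v c, c != 0 /\ u * f + v * g = c%:P).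
Proof.
have [[a [fa ga]]|prim] := pselect (exists a, fiber a f = 0 /\ fiber a g = 0).
  have [u uE] := fiber_eq0 fa; have [v vE] := fiber_eq0 ga; left.
  exists ('X - a%:P)%:P, u, v; split=> // k /polyC_inj e.
  have := congr1 (@size _ \o @polyseq C) e.
  by rewrite /= size_XsubC size_polyC; case: eqP.
have {}prim a : ~ (fiber a f = 0 /\ fiber a g = 0) by move=> H; apply: prim; exists a.
have nonc (r : {poly {poly C}}) : (1 < size r)%N -> forall k, r <> k%:P%:P.
  by move=> sr k e; move: sr; rewrite e size_polyC; case: eqP.
have [f0|f0] := eqVneq f 0.
  have [/size1_polyC gE|sg] := leqP (size g) 1; last first.
    by left; exists g, 0, 1; rewrite mulr0 mulr1; split=> //; apply: nonc.
  right; split=> //; exists 0, 1, g`_0; rewrite mul0r add0r mul1r -gE; split=> //.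
  apply/eqP => g0; apply: (prim 0); rewrite gE g0 f0 polyC0.
  by rewrite /fiber map_poly0.
have [g0|g0] := eqVneq g 0.
  have [/size1_polyC fE|sf] := leqP (size f) 1; last first.
    by left; exists f, 1, 0; rewrite mulr0 mulr1; split=> //; apply: nonc.
  right; split=> //; exists 1, 0, f`_0; rewrite mul0r addr0 mul1r -fE; split=> //.
  by apply/eqP => z; move: f0; rewrite fE z eqxx.
have [/size1_polyC fE|sf] := leqP (size f) 1.
  right; split=> //; exists 1, 0, f`_0; rewrite mul0r addr0 mul1r -fE; split=> //.
  by apply/eqP => z; move: f0; rewrite fE z eqxx.
have [/size1_polyC gE|sg] := leqP (size g) 1.
  right; split=> //; exists 0, 1, g`_0; rewrite mul0r add0r mul1r -gE; split=> //.
  by apply/eqP => z; move: g0; rewrite gE z eqxx.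
have [r0|r0] := eqVneq (resultant f g) 0; last first.
  right; split=> //; have [[u v] /= _ e] := resultant_in_ideal sf sg.
  by exists u, v, (resultant f g); rewrite e.
left; have : (1 < size (gcdp f g))%N by rewrite -resultant_eq0 r0.
set d := gcdp f g => sd.
have d0 : d != 0 by rewrite -size_poly_gt0 (ltn_trans _ sd).
have [c [r [c0 dE prim_r]]] := primitive_part d0.
have sr : (1 < size r)%N by move: sd; rewrite dE mul_polyC size_scale.
(* Pseudo-division by [d] leaves a factor [e] from C[x]; it cancels because [r] is primitive. *)
have divides (w : {poly {poly C}}) : d %| w -> exists k, w = r * k.
  move=> /Pdiv.Idomain.dvdpP [[e s] /= e0 eE].
  have [||||k [kE _]] := @primitive_cancel e r 0 w 0 (s * c%:P).
  - by move=> a [/prim_r].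
  - by [].
  - by rewrite mul_polyC eE dE mulrA.
  - by rewrite !mulr0.
  by exists k; rewrite mulrC.
have [u uE] := divides f (dvdp_gcdl f g).
have [v vE] := divides g (dvdp_gcdr f g).
by exists r, u, v; split=> //; apply: nonc.
Qed.

End Bivariate.

(** * Root perturbation and generic choices *)

Section Generic.
Variable C : numClosedFieldType.
Implicit Types (a x y z w s t : C) (f g : {poly C}) (P : {poly {poly C}}).

(** If every root stays at distance at least [e] from 1, then [|u - a| <= 2 * |1 - a|] for each root
    [a], and multiplying these bounds contradicts the growth from 1 to [u]. *)
Lemma root_near_one f N e u : (size f <= N.+1)%N -> 0 < e -> `|u - 1| <= e ->
  2 ^+ N * `|f.[1]| < `|f.[u]| -> exists2 w, f.[w] = 0 & `|w - 1| < e.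
Proof.
move=> sf e0 ue lt; apply: contrapT => nw.
have f0 : f != 0 by apply: contraTneq lt => ->; rewrite !horner0 normr0 mulr0 ltxx.
have [rs frs] := closed_field_poly_normal f.
have fE w : f.[w] = lead_coef f * \prod_(a <- rs) (w - a).
  by rewrite {1}frs !hornerE horner_prod; under eq_bigr do rewrite !hornerE.
have srs : (size rs <= N)%N.
  by move: sf; rewrite frs size_scale ?lead_coef_eq0 // size_prod_XsubC.
have far a : a \in rs -> `|u - a| <= 2 * `|1 - a|.
  move=> ars; have le : e <= `|1 - a|.
    have [//|lt1] := real_leP (gtr0_real e0) (normr_real (1 - a)).
    case: nw; exists a; last by rewrite distrC.
    by rewrite fE (big_rem a) //= subrr mul0r mulr0.
  rewrite mulr_natl mulr2n -[u - a](subrK (1 - a)) addrC.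
  apply: le_trans (ler_normD _ _) _; rewrite addrC lerD //.
  by apply: le_trans le; rewrite opprB addrA subrK.
have : `|f.[u]| <= 2 ^+ N * `|f.[1]|.
  rewrite !fE !normrM mulrCA ler_wpM2l ?normr_ge0 //.
  apply: (@le_trans _ _ (2 ^+ size rs * `|\prod_(a <- rs) (1 - a)|)); last first.
    by rewrite ler_wpM2r ?normr_ge0 // ler_eXn2l // ltr1n.
  elim: (rs) far => [_|a l IH far]; first by rewrite !big_nil mul1r.
  rewrite !big_cons !normrM exprS /= mulrACA ler_pM ?normr_ge0 //.
    by apply: far; rewrite inE eqxx.
  by apply: IH => b hb; apply: far; rewrite inE hb orbT.
by move=> /(lt_le_trans lt); rewrite ltxx.
Qed.

Lemma bipoly_neq0_circle P : P != 0 ->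
  exists s1 s2, [/\ `|s1| = 1, `|s2| = 1 & P.[s2%:P].[s1] != 0].
Proof.
move=> P0; have lc0 : lead_coef P != 0 by rewrite lead_coef_eq0.
have [s1 [s1_1 _ n1]] := poly_neq0_near lc0 (normr1 C) ltr01.
have f0 : fiber s1 P != 0.
  apply: contraNneq n1 => e; have := congr1 (fun p : {poly C} => p`_(size P).-1) e.
  by rewrite coef_map coef0 /= => /eqP.
have [s2 [s2_1 _ n2]] := poly_neq0_near f0 (normr1 C) ltr01.
by exists s1, s2; rewrite -fiberE.
Qed.

Lemma bipoly_slice P x y : exists f, forall w, f.[w] = P.[(y * w)%:P].[x * w].
Proof.
exists (\sum_(i < size P) (P`_i \Po (x *: 'X)) * (y *: 'X) ^+ i) => w.
rewrite [P.[_]]horner_coef !horner_sum; apply: eq_bigr => i _.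
by rewrite !hornerE horner_comp !hornerE.
Qed.

Lemma poly_roots f : f != 0 -> exists rs : seq C, forall x, f.[x] = 0 -> x \in rs.
Proof.
move=> f0; have [rs frs] := closed_field_poly_normal f; exists rs => x /eqP.
by rewrite frs -rootE rootZ ?lead_coef_eq0 // root_prod_XsubC.
Qed.

(** The two requirements exclude only finitely many [s]: the roots of [A] and those of [B]. *)
Lemma generic_direction P f g t1 t2 d : P != 0 -> f != 0 -> g != 0 ->
  `|t1| = 1 -> `|t2| = 1 -> 0 < d -> exists s,
  [/\ `|s| = 1, `|s - t1| < d, exists w, P.[(t2 * w)%:P].[s * w] != 0 &
      forall w, w != 0 -> ~ (f.[s * w] = 0 /\ g.[t2 * w] = 0)].
Proof.
move=> P0 f0 g0 t11 t21 d0.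
have t20 : t2 != 0 by rewrite -normr_eq0 t21 oner_eq0.
have [x [y [x1 y1 Pxy]]] := bipoly_neq0_circle P0.
have y0 : y != 0 by rewrite -normr_eq0 y1 oner_eq0.
pose w0 := y / t2.
have w00 : w0 != 0 by rewrite mulf_neq0 ?invr_neq0.
pose A := P.[(t2 * w0)%:P] \Po (w0 *: 'X).
have A0 : A != 0.
  apply: contraNneq Pxy => e; have := congr1 (fun p => p.[x / w0]) e.
  rewrite horner_comp hornerZ hornerX horner0 [w0 * (x / w0)]mulrC divfK // => <-.
  by rewrite /w0 [t2 * _]mulrC divfK.
have [rf rfP] := poly_roots f0; have [rg rgP] := poly_roots g0.
(* If [s * w = a] and [t2 * w = b], then [b * s = t2 * a]; a root [b = 0] cannot occur for [w != 0],
   hence the factor 1. *)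
pose B := \prod_(a <- rf) \prod_(b <- rg)
  (if b == 0 then 1 else b *: 'X - (t2 * a)%:P).
have B0 : B != 0.
  rewrite prodf_seq_neq0; apply/allP => a _ /=; rewrite prodf_seq_neq0.
  apply/allP => b _ /=; case: ifP => [_|/negbT b0]; first exact: oner_neq0.
  rewrite -size_poly_gt0 size_polyDl ?size_scale ?size_polyX // size_polyN size_polyC.
  by case: (_ != 0).
have [s [s1 st]] := poly_neq0_near (mulf_neq0 A0 B0) t11 d0.
rewrite hornerM mulf_eq0 negb_or => /andP[As Bs].
exists s; split=> //.
  by exists w0; move: As; rewrite horner_comp hornerZ hornerX [w0 * s]mulrC.
move=> w w_0 [/rfP fa /rgP gb]; move: Bs; rewrite /B horner_prod prodf_seq_neq0.
move=> /allP /(_ _ fa) /=; rewrite horner_prod prodf_seq_neq0.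
move=> /allP /(_ _ gb) /=; rewrite (negPf (mulf_neq0 t20 w_0)).
rewrite hornerD hornerN hornerZ hornerX hornerC.
by rewrite (_ : _ - _ = 0) ?eqxx //; ring.
Qed.

(** For each unimodular [w] in [rs] the forbidden [s] are the roots of a nonzero affine
    polynomial. *)
Lemma generic_third (rs : seq C) (p1 p2 : C -> C) t d :
  (forall w, `|w| = 1 -> p1 w != 0 \/ p2 w != 0) -> `|t| = 1 -> 0 < d ->
  exists s, [/\ `|s| = 1, `|s - t| < d &
    forall w, w \in rs -> `|w| = 1 -> p1 w + s * w * p2 w != 0].
Proof.
move=> H t1 d0.
pose B := \prod_(w <- rs | `|w| == 1) ((p1 w)%:P + (w * p2 w) *: 'X).
have B0 : B != 0.
  rewrite prodf_seq_neq0; apply/allP => w _ /=; apply/implyP => /eqP w1.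
  have w0 : w != 0 by rewrite -normr_eq0 w1 oner_eq0.
  apply/eqP => e; have := congr1 (fun p : {poly C} => (p`_0, p`_1)) e.
  rewrite !coefD !coefZ !coefX !coefC /= !mulr0 addr0 add0r mulr1 => -[p10 /eqP].
  rewrite mulf_eq0 (negPf w0) /= => /eqP p20.
  by have [] := H w w1; rewrite ?p10 ?p20 eqxx.
have [s [s1 st Bs]] := poly_neq0_near B0 t1 d0.
exists s; split=> // w wrs w1; move: Bs; rewrite horner_prod prodf_seq_neq0.
by move=> /allP /(_ w wrs); rewrite w1 eqxx /= !hornerE mulrAC [w * s]mulrC.
Qed.

End Generic.

(** * Reflection and slices *)

Section Reflection.
Variables (R : realType) (m n : nat).
Local Notation C := (R[i]).
Local Notation mat := 'M[C]_(m.+1, n.+1).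
Implicit Types (M P : mat) (x y z w s t l : C).

Lemma ev2D M P x y : ev2 (M + P) x y = ev2 M x y + ev2 P x y.
Proof.
rewrite /ev2 -big_split; apply: eq_bigr => i _; rewrite -big_split.
by apply: eq_bigr => j _; rewrite mxE !mulrDl.
Qed.

Lemma ev2Z l M x y : ev2 (l *: M) x y = l * ev2 M x y.
Proof.
rewrite /ev2 big_distrr; apply: eq_bigr => i _; rewrite big_distrr.
by apply: eq_bigr => j _; rewrite mxE /= !mulrA.
Qed.

Lemma ev2N M x y : ev2 (- M) x y = - ev2 M x y.
Proof. by rewrite -scaleN1r ev2Z mulN1r. Qed.

Lemma reflD M P : refl (M + P) = refl M + refl P.
Proof. by apply/matrixP => i j; rewrite !mxE rmorphD. Qed.

Lemma reflZ l M : refl (l *: M) = l^* *: refl M.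
Proof. by apply/matrixP => i j; rewrite !mxE rmorphM. Qed.

Lemma reflN M : refl (- M) = - refl M.
Proof. by apply/matrixP => i j; rewrite !mxE rmorphN. Qed.

Lemma reflK M : refl (refl M) = M.
Proof. by apply/matrixP => i j; rewrite !mxE !rev_ordK conjCK. Qed.

Lemma ev2_refl M x y : x != 0 -> y != 0 ->
  ev2 (refl M) x y = x ^+ m * y ^+ n * (ev2 M (x^*)^-1 (y^*)^-1)^*.
Proof.
move=> x0 y0; rewrite /ev2 rmorph_sum big_distrr /= (reindex_inj rev_ord_inj) /=.
apply: eq_bigr => i _; rewrite rmorph_sum big_distrr (reindex_inj rev_ord_inj) /=.
apply: eq_bigr => j _; rewrite mxE !rev_ordK !rmorphM !rmorphXn /=.
rewrite !conj_invconj !exprVn !subSS.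
have -> : x ^+ m = x ^+ (m - i) * x ^+ i by rewrite -exprD subnK // -ltnS.
have -> : y ^+ n = y ^+ (n - j) * y ^+ j by rewrite -exprD subnK // -ltnS.
by field; rewrite !expf_neq0.
Qed.

Lemma ev2_refl_circle M x y : `|x| = 1 -> `|y| = 1 ->
  ev2 (refl M) x y = x ^+ m * y ^+ n * (ev2 M x y)^*.
Proof.
move=> x1 y1; rewrite ev2_refl ?(conj_circle x1) ?(conj_circle y1) ?invrK //.
  by rewrite -normr_eq0 x1 oner_eq0.
by rewrite -normr_eq0 y1 oner_eq0.
Qed.

Lemma norm_ev2_refl M x y : `|x| = 1 -> `|y| = 1 ->
  `|ev2 (refl M) x y| = `|ev2 M x y|.
Proof.
move=> x1 y1; rewrite ev2_refl_circle // !normrM !normrX x1 y1 !expr1n !mul1r.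
exact: norm_conjC.
Qed.

Definition bipoly M : {poly {poly C}} :=
  \sum_(i < m.+1) \sum_(j < n.+1) (M i j *: 'X^i)%:P * 'X^j.

Lemma bipolyE M x y : (bipoly M).[y%:P].[x] = ev2 M x y.
Proof.
rewrite !horner_sum; apply: eq_bigr => i _; rewrite !horner_sum.
apply: eq_bigr => j _.
by rewrite hornerM hornerXn hornerC hornerM hornerZ hornerXn -rmorphXn hornerC.
Qed.

(** Restriction to the monomial curve [w |-> (s1 w^a, s2 w^b)]. For unimodular [s1], [s2] inversion
    in the unit circle acts on such a curve through its parameter, as [conj_slice_point] records. *)
Definition slice M s1 s2 (a b : nat) : {poly C} :=
  \sum_(i < m.+1) \sum_(j < n.+1) (M i j * s1 ^+ i * s2 ^+ j) *: 'X^(a * i + b * j).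

Lemma sliceE M s1 s2 a b w :
  (slice M s1 s2 a b).[w] = ev2 M (s1 * w ^+ a) (s2 * w ^+ b).
Proof.
rewrite !horner_sum; apply: eq_bigr => i _; rewrite !horner_sum.
apply: eq_bigr => j _; rewrite hornerZ hornerXn !exprMn -!exprM exprD.
by ring.
Qed.

Lemma size_slice M s1 s2 a b : (size (slice M s1 s2 a b) <= (a * m + b * n).+1)%N.
Proof.
apply: (leq_trans (size_sum _ _ _)); apply/bigmax_leqP => i _.
apply: (leq_trans (size_sum _ _ _)); apply/bigmax_leqP => j _.
apply: (leq_trans (size_scale_leq _ _)); rewrite size_polyXn ltnS.
by rewrite leq_add // leq_mul // -ltnS.
Qed.

Lemma conj_slice_point s w a : `|s| = 1 ->
  ((s * w ^+ a)^*)^-1 = s * ((w^*)^-1) ^+ a.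
Proof.
by move=> s1; rewrite rmorphM rmorphXn /= (conj_circle s1) invfM invrK exprVn.
Qed.

(** Since inversion preserves the curve, reflection of bidegree [(m, n)] restricts to reflection of
    degree [a * m + b * n]. *)
Lemma slice_reflects M s1 s2 a b : `|s1| = 1 -> `|s2| = 1 ->
  reflects (s1 ^+ m * s2 ^+ n) (a * m + b * n) (slice M s1 s2 a b)
    (slice (refl M) s1 s2 a b).
Proof.
move=> s11 s21 w w0; rewrite !sliceE ev2_refl ?mulf_neq0 ?expf_neq0 //;
  try by rewrite -normr_eq0 ?s11 ?s21 oner_eq0.
rewrite !conj_slice_point // !exprMn -!exprM exprD.
by ring.
Qed.

Definition slice3 P1 P2 s1 s2 s3 a b c : {poly C} :=
  slice P1 s1 s2 a b + s3 *: 'X^c * slice P2 s1 s2 a b.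

Definition rslice3 P1 P2 s1 s2 s3 a b c : {poly C} :=
  s3 *: 'X^c * slice (refl P1) s1 s2 a b + slice (refl P2) s1 s2 a b.

Lemma slice3E P1 P2 s1 s2 s3 a b c w : (slice3 P1 P2 s1 s2 s3 a b c).[w] =
  peval P1 P2 (s1 * w ^+ a) (s2 * w ^+ b) (s3 * w ^+ c).
Proof. by rewrite hornerD hornerM hornerZ hornerXn !sliceE. Qed.

Lemma rslice3E P1 P2 s1 s2 s3 a b c w : (rslice3 P1 P2 s1 s2 s3 a b c).[w] =
  ptilde P1 P2 (s1 * w ^+ a) (s2 * w ^+ b) (s3 * w ^+ c).
Proof. by rewrite hornerD hornerM hornerZ hornerXn !sliceE. Qed.

Lemma size_slice3 P1 P2 s1 s2 s3 a b c :
  (size (slice3 P1 P2 s1 s2 s3 a b c) <= (a * m + b * n + c).+1)%N.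
Proof.
apply: (leq_trans (size_polyD _ _)); rewrite geq_max.
rewrite (leq_trans (size_slice _ _ _ _ _)) ?ltnS ?leq_addr //=.
rewrite -scalerAl (leq_trans (size_scale_leq _ _)) //.
apply: (leq_trans (size_polyMleq _ _)); rewrite size_polyXn addSn /= addnC -addSn.
by rewrite leq_add2r size_slice.
Qed.

Lemma slice3_reflects P1 P2 s1 s2 s3 a b c :
  `|s1| = 1 -> `|s2| = 1 -> `|s3| = 1 ->
  reflects (s1 ^+ m * s2 ^+ n * s3) (a * m + b * n + c)
    (slice3 P1 P2 s1 s2 s3 a b c) (rslice3 P1 P2 s1 s2 s3 a b c).
Proof.
move=> s11 s21 s31 w w0; have s30 : s3 != 0 by rewrite -normr_eq0 s31 oner_eq0.
rewrite !(hornerD, hornerM, hornerZ, hornerXn).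
rewrite !(slice_reflects _ _ _ s11 s21 w0) !(rmorphD, rmorphM, rmorphXn) /=.
rewrite (conj_circle s31) !conj_invconj exprVn !exprD.
by field; rewrite s30 expf_neq0.
Qed.

End Reflection.

(** * Consequences of coprimality *)

Section CommonFactor.
Variables (R : realType) (m n : nat).
Local Notation C := (R[i]).
Implicit Types (f g h r u v : {poly {poly C}}) (x y z : C).

Lemma bihorner_coef N f x y : (size f <= N)%N -> (sizeY f <= N)%N ->
  f.[y%:P].[x] = \sum_(i < N) \sum_(j < N) f`_j`_i * x ^+ i * y ^+ j.
Proof.
move=> sf sYf; rewrite exchange_big (horner_coef_wide _ sf) horner_sum /=.
apply: eq_bigr => j _; rewrite hornerM -rmorphXn hornerC.
rewrite (horner_coef_wide x (leq_trans (max_size_coefXY f j) sYf)) big_distrl.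
by [].
Qed.

Lemma bipoly_is_poly3 f g :
  is_poly3 (fun x y z => f.[y%:P].[x] + z * g.[y%:P].[x]).
Proof.
(* The [.+2] puts the exponents 0 and 1 of the third variable in range. *)
pose N := (maxn (maxn (size f) (sizeY f)) (maxn (size g) (sizeY g))).+2.
have [[fN fYN] [gN gYN]] : ((size f <= N)%N * (sizeY f <= N)%N) *
    ((size g <= N)%N * (sizeY g <= N)%N).
  by split; split; rewrite /N leqW // leqW // !leq_max leqnn ?orbT.
exists N, (fun i j k => (if k == 0%N then f`_j`_i else 0) +
                        (if k == 1%N then g`_j`_i else 0)) => x y z.
rewrite (bihorner_coef x y fN fYN) (bihorner_coef x y gN gYN) big_distrr -big_split.
apply: eq_bigr => i _; rewrite big_distrr -big_split; apply: eq_bigr => j _ /=.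
rewrite /N !big_ord_recl big1 => [|k _] /=; last by rewrite addr0 !mul0r.
by rewrite expr0 expr1; ring.
Qed.

Lemma bihorner_is_poly3 f : is_poly3 (fun x y _ => f.[y%:P].[x]).
Proof.
have [N [c E]] := bipoly_is_poly3 f 0; exists N, c => x y z.
by rewrite -E !horner0 mulr0 addr0.
Qed.

Lemma bipoly_eq_circle f g : (forall x y, `|x| = 1 -> `|y| = 1 ->
  f.[y%:P].[x] = g.[y%:P].[x]) -> f = g.
Proof.
move=> e; apply/eqP; rewrite -subr_eq0; apply/negPn/negP => nz.
have [x [y [x1 y1]]] := bipoly_neq0_circle nz.
by rewrite !(hornerD, hornerN) e // subrr eqxx.
Qed.

Lemma bihorner_nonconst r : (forall k, r <> k%:P%:P) ->
  ~ is_const3 (fun x y _ => r.[y%:P].[x]).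
Proof.
move=> nc [k kE]; apply: (nc k); apply: bipoly_eq_circle => x y _ _.
by rewrite (kE x y 0) !hornerC.
Qed.

(** [c] comes from the ideal and controls x. Over each of its roots one of the two fibers is a
    nonzero polynomial in y, and the product of these is [e]. *)
Lemma common_zeros_finite f g :
  (forall a, ~ (fiber a f = 0 /\ fiber a g = 0)) ->
  (exists u v c, c != 0 /\ u * f + v * g = c%:P) ->
  exists c e : {poly C}, [/\ c != 0, e != 0 & forall x y,
    f.[y%:P].[x] = 0 -> g.[y%:P].[x] = 0 -> c.[x] = 0 /\ e.[y] = 0].
Proof.
move=> prim [u [v [c [c0 E]]]]; have [rs rsP] := poly_roots c0.
pose fib a := if fiber a f == 0 then fiber a g else fiber a f.
have fib0 a : fib a != 0.
  rewrite /fib; case: ifP => [/eqP fa|/negbT //].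
  by apply/eqP => ga; apply: (prim a).
exists c, (\prod_(a <- rs) fib a); split=> // [|x y fxy gxy].
  by rewrite prodf_seq_neq0; apply/allP => a _; rewrite fib0.
have cx : c.[x] = 0.
  have := congr1 (fun p => p.[y%:P].[x]) E.
  by rewrite hornerC !(hornerD, hornerM) fxy gxy !mulr0 addr0.
split=> //; rewrite horner_prod (big_rem x) ?rsP //= [_.[y]](_ : _ = 0) ?mul0r //.
by rewrite /fib; case: ifP => _; rewrite fiberE.
Qed.

Variables (P1 P2 : 'M[C]_(m.+1, n.+1)).
Hypothesis irr : irreducible3 (peval P1 P2).
Hypothesis p_neq0 : forall z1 z2 z3 : C, inD z1 -> inD z2 -> inD z3 ->
  peval P1 P2 z1 z2 z3 != 0.
Hypothesis cop : ~ common_factor3 (peval P1 P2) (ptilde P1 P2).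

Lemma peval_bipoly :
  peval P1 P2 = fun x y z => (bipoly P1).[y%:P].[x] + z * (bipoly P2).[y%:P].[x].
Proof. by apply/funext=> x; apply/funext=> y; apply/funext=> z; rewrite !bipolyE. Qed.

Lemma ptilde_neq_scale (l : C) :
  ~ (forall x y z, ptilde P1 P2 x y z = l * peval P1 P2 x y z).
Proof.
move=> E; apply: cop; case: irr => pp [nc _].
exists (peval P1 P2), (fun x y _ => (1%:P%:P : {poly {poly C}}).[y%:P].[x]),
  (fun x y _ => (l%:P%:P : {poly {poly C}}).[y%:P].[x]).
split=> //; try exact: bihorner_is_poly3.
by move=> x y z; rewrite !hornerC mulr1 E mulrC.
Qed.

Lemma bipoly_refl_eq0 (M : 'M[C]_(m.+1, n.+1)) : bipoly (refl M) = 0 -> bipoly M = 0.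
Proof.
move=> M0; apply: bipoly_eq_circle => x y x1 y1; apply/eqP.
rewrite bipolyE !horner0 -normr_eq0 -norm_ev2_refl // normr_eq0.
by rewrite -bipolyE M0 !horner0.
Qed.

Lemma bipoly_P1_neq0 : bipoly P1 != 0.
Proof.
apply/eqP => e; have i0 : inD (0 : C) by rewrite /inD normr0 ltr01.
by have := p_neq0 i0 i0 i0; rewrite peval_bipoly e !horner0 mul0r addr0 eqxx.
Qed.

(** A common factor [r] would give [p = r * (u + z3 * v)]; irreducibility makes the second factor
    constant, so [v = 0] and [P2] vanishes. *)
Lemma coefficients_coprime : bipoly P2 != 0 ->
  (forall a, ~ (fiber a (bipoly P1) = 0 /\ fiber a (bipoly P2) = 0)) /\
  exists u v c, c != 0 /\ u * bipoly P1 + v * bipoly P2 = c%:P.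
Proof.
move=> P20; have [[r [u [v [E1 E2 nc]]]]|//] :=
  common_factor_or_ideal (bipoly P1) (bipoly P2).
case: irr => _ [_ /(_ _ _ (bihorner_is_poly3 r) (bipoly_is_poly3 u v))].
case=> [x y z|/(bihorner_nonconst nc) //|[k kE]].
  by rewrite peval_bipoly E1 E2 !hornerM; ring.
case/eqP: P20; rewrite E2; suff -> : v = 0 by rewrite mulr0.
apply: bipoly_eq_circle => x y _ _; rewrite !horner0.
by have := etrans (kE x y 1) (esym (kE x y 0)); rewrite mul0r mul1r => /addrI.
Qed.

(** This is the determinant of [p = ptilde = 0] as a linear system in [1] and [z3]. Were it zero
    with [P2] nonzero, coprimality of the coefficients would force [ptilde = k * p], and [p] would
    be a common factor. *)
Lemma discriminant_neq0 :
  bipoly P1 * bipoly (refl P1) - bipoly P2 * bipoly (refl P2) != 0.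
Proof.
rewrite subr_eq0; apply/eqP => E; have [P20|P20] := eqVneq (bipoly P2) 0.
  move: E; rewrite P20 mul0r => /eqP; rewrite mulf_eq0 (negPf bipoly_P1_neq0) /=.
  by move=> /eqP /bipoly_refl_eq0 /eqP; rewrite (negPf bipoly_P1_neq0).
have [prim [u [v [c [c0 cE]]]]] := coefficients_coprime P20.
(* Multiplying [u * p1 + v * p2 = c] by a reflected coefficient and using [E] gives a multiple of
   [p1], respectively [p2], with the same cofactor. *)
have [||k [a_E b_E]] := @primitive_cancel _ c _ _ (bipoly (refl P2)) (bipoly (refl P1))
  (u * bipoly (refl P2) + v * bipoly (refl P1)) prim c0.
- rewrite -cE !mulrDl; congr (_ + _); first by rewrite mulrAC.
  by rewrite -!mulrA -E; congr (_ * _); rewrite mulrC.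
- rewrite -cE !mulrDl; congr (_ + _); last by rewrite mulrAC.
  by rewrite -!mulrA E; congr (_ * _); rewrite mulrC.
apply: cop; case: irr => pp [nc _].
exists (peval P1 P2), (fun x y _ => (1%:P%:P : {poly {poly C}}).[y%:P].[x]),
  (fun x y _ => k.[y%:P].[x]).
split=> //; try exact: bihorner_is_poly3.
move=> x y z; rewrite !hornerC mulr1; split=> //.
by rewrite /ptilde -!bipolyE a_E b_E peval_bipoly !hornerM; ring.
Qed.

Lemma coefficients_zeros_finite : exists c e : {poly C}, [/\ c != 0, e != 0 &
  forall x y, `|x| = 1 -> `|y| = 1 -> ev2 P1 x y = 0 -> ev2 P2 x y = 0 ->
    c.[x] = 0 /\ e.[y] = 0].
Proof.
have [P20|P20] := eqVneq (bipoly P2) 0; last first.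
  have [prim id] := coefficients_coprime P20.
  have [c [e [c0 e0 H]]] := common_zeros_finite prim id.
  by exists c, e; split=> // x y _ _ z1 z2; apply: H; rewrite bipolyE.
(* When [P2 = 0], [refl P1] takes its place: it has the modulus of [P1] on the torus, and a factor
   shared with [P1] would divide both [p] and [ptilde = z3 * refl P1]. *)
have [[r [u [v [E1 E2 nc]]]]|[prim id]] :=
  common_factor_or_ideal (bipoly P1) (bipoly (refl P1)).
  have rP20 : bipoly (refl P2) = 0 by apply: bipoly_refl_eq0; rewrite reflK.
  case: cop; exists (fun x y _ => r.[y%:P].[x]), (fun x y _ => u.[y%:P].[x]),
    (fun x y z => (0 : {poly {poly C}}).[y%:P].[x] + z * v.[y%:P].[x]).
  split; try exact: bihorner_is_poly3; try exact: bipoly_is_poly3.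
    exact: bihorner_nonconst.
  move=> x y z; rewrite peval_bipoly /ptilde -!bipolyE P20 rP20 E1 E2 !horner0 !hornerM.
  by split; ring.
have [c [e [c0 e0 H]]] := common_zeros_finite prim id.
exists c, e; split=> // x y x1 y1 z1 _; apply: H; rewrite bipolyE //.
by apply/eqP; rewrite -normr_eq0 norm_ev2_refl // z1 normr0.
Qed.

End CommonFactor.

(** * Continuity and density of slices *)

Section Continuity.
Variable C : numClosedFieldType.
Implicit Types (x y z w e d : C) (f g : C -> C -> C -> C).

(** Tolerances are taken in [C] itself, where positivity already forces them to be real. *)
Definition cont3 f := forall x y z e, 0 < e -> exists d, 0 < d /\
  forall x' y' z', `|x' - x| < d -> `|y' - y| < d -> `|z' - z| < d ->
    `|f x' y' z' - f x y z| < e.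

(** The order on [C] is only partial, so [d1 * d2 / (d1 + d2)] replaces the minimum. *)
Lemma common_bound (d1 d2 : C) : 0 < d1 -> 0 < d2 ->
  exists d, [/\ 0 < d, d <= d1 & d <= d2].
Proof.
move=> d10 d20; have d12 : 0 < d1 + d2 by rewrite addr_gt0.
exists (d1 * d2 / (d1 + d2)); split.
- by rewrite divr_gt0 ?mulr_gt0.
- by rewrite ler_pdivrMr // ler_pM2l // lerDr ltW.
- by rewrite ler_pdivrMr // mulrC ler_pM2l // lerDl ltW.
Qed.

Lemma cont3_cst a : cont3 (fun _ _ _ => a).
Proof. by move=> x y z e e0; exists 1; split=> // *; rewrite subrr normr0. Qed.

Lemma cont3_1 : cont3 (fun x _ _ => x).
Proof. by move=> x y z e e0; exists e. Qed.

Lemma cont3_2 : cont3 (fun _ y _ => y).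
Proof. by move=> x y z e e0; exists e. Qed.

Lemma cont3_3 : cont3 (fun _ _ z => z).
Proof. by move=> x y z e e0; exists e. Qed.

Lemma cont3_add f g : cont3 f -> cont3 g -> cont3 (fun x y z => f x y z + g x y z).
Proof.
move=> cf cg x y z e e0; have e2 : 0 < e / 2 by rewrite divr_gt0.
have [d1 [d10 H1]] := cf x y z _ e2; have [d2 [d20 H2]] := cg x y z _ e2.
have [d [d0 dd1 dd2]] := common_bound d10 d20.
exists d; split=> // x' y' z' hx hy hz.
rewrite opprD addrACA [e]splitr; apply: le_lt_trans (ler_normD _ _) _.
by apply: ltrD; [apply: H1|apply: H2]; apply: lt_le_trans; eassumption.
Qed.

Lemma cont3_mul f g : cont3 f -> cont3 g -> cont3 (fun x y z => f x y z * g x y z).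
Proof.
move=> cf cg x y z e e0.
set F := f x y z; set G := g x y z; pose K := 1 + `|F| + `|G|.
have K0 : 0 < K by rewrite /K -addrA ltr_pwDl // addr_ge0.
have [e1 [e10 e11 e1K]] := common_bound ltr01 (divr_gt0 e0 K0).
have [d1 [d10 H1]] := cf x y z _ e10; have [d2 [d20 H2]] := cg x y z _ e10.
have [d [d0 dd1 dd2]] := common_bound d10 d20.
exists d; split=> // x' y' z' hx hy hz.
have h1 : `|f x' y' z' - F| < e1 by apply: H1; apply: lt_le_trans; eassumption.
have h2 : `|g x' y' z' - G| < e1 by apply: H2; apply: lt_le_trans; eassumption.
move: (f x' y' z') (g x' y' z') h1 h2 => f' g' h1 h2.
rewrite ler_pdivlMr // in e1K; apply: lt_le_trans e1K.
have -> : f' * g' - F * G = (f' - F) * (g' - G) + F * (g' - G) + (f' - F) * G by ring.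
apply: le_lt_trans (ler_normD _ _) _.
rewrite /K [e1 * _]mulrDr [e1 * (1 + _)]mulrDr mulr1.
apply: ltr_leD; last first.
  by rewrite normrM ler_wpM2r // ltW.
apply: le_lt_trans (ler_normD _ _) _; apply: ltr_leD; last first.
  by rewrite normrM mulrC ler_wpM2r // ltW.
rewrite normrM; apply: le_lt_trans h1; rewrite ler_piMr // ltW //.
exact: lt_le_trans h2 e11.
Qed.

Lemma cont3_exp f k : cont3 f -> cont3 (fun x y z => f x y z ^+ k).
Proof.
move=> cf; elim: k => [|k IH]; first exact: cont3_cst.
have -> : (fun x y z => f x y z ^+ k.+1) = (fun x y z => f x y z * f x y z ^+ k).
  by apply/funext=> x; apply/funext=> y; apply/funext=> z; rewrite exprS.
exact: cont3_mul.
Qed.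

Lemma cont3_sum k (F : 'I_k -> C -> C -> C -> C) : (forall i, cont3 (F i)) ->
  cont3 (fun x y z => \sum_(i < k) F i x y z).
Proof.
elim: k F => [|k IH] F cF.
  have -> : (fun x y z => \sum_(i < 0) F i x y z) = (fun _ _ _ => 0).
    by apply/funext=> x; apply/funext=> y; apply/funext=> z; rewrite big_ord0.
  exact: cont3_cst.
have -> : (fun x y z => \sum_(i < k.+1) F i x y z) =
    (fun x y z => F ord0 x y z + \sum_(i < k) F (lift ord0 i) x y z).
  by apply/funext=> x; apply/funext=> y; apply/funext=> z; rewrite big_ord_recl.
by apply: cont3_add => //; apply: (IH (fun i => F (lift ord0 i))).
Qed.

End Continuity.

Section Contractive.
Local Open Scope classical_set_scope.
Local Open Scope ring_scope.
Variables (R : realType) (m n : nat).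
Local Notation C := (R[i]).
Implicit Types (M : 'M[C]_(m.+1, n.+1)) (x y z w s : C).

Lemma cont3_ev2 M : cont3 (fun x y _ => ev2 M x y).
Proof.
apply: (cont3_sum (F := fun i x y _ => \sum_(j < n.+1) M i j * x ^+ i * y ^+ j)) => i.
apply: (cont3_sum (F := fun j x y _ => M i j * x ^+ i * y ^+ j)) => j.
apply: cont3_mul; last exact: (cont3_exp j (@cont3_2 _)).
apply: cont3_mul; first exact: cont3_cst.
exact: (cont3_exp i (@cont3_1 _)).
Qed.

Lemma cont3_peval (P1 P2 : 'M[C]_(m.+1, n.+1)) : cont3 (peval P1 P2).
Proof.
apply: (cont3_add (cont3_ev2 P1)); apply: (cont3_mul (@cont3_3 _)).
exact: cont3_ev2.
Qed.

Lemma cont3_ptilde (P1 P2 : 'M[C]_(m.+1, n.+1)) : cont3 (ptilde P1 P2).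
Proof.
apply: (@cont3_add _ (fun x y z => z * ev2 (refl P1) x y)); last exact: cont3_ev2.
apply: (cont3_mul (@cont3_3 _)); exact: cont3_ev2.
Qed.

(** Take the least exponent whose power is at most [x + (1 - rho)]: consecutive powers of [rho]
    differ by at most [1 - rho]. *)
Lemma pow_approx (rho x : R) : 0 < rho < 1 -> 0 <= x <= 1 ->
  exists a : nat, (0 < a)%N /\ `|rho ^+ a - x| <= 1 - rho.
Proof.
move=> /andP[r0 r1] /andP[x0 x1].
have ex : exists a : nat, rho ^+ a <= x + (1 - rho).
  have : (fun k => rho ^+ k) @ \oo --> 0 by apply: cvg_expr; rewrite ger0_norm // ltW.
  move=> /cvgrPdist_lt /(_ (1 - rho)); rewrite subr_gt0 => /(_ r1) [k _ /(_ k (leqnn k))].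
  rewrite sub0r normrN ger0_norm ?exprn_ge0 // ?ltW // => /ltW h.
  by exists k; apply: le_trans h _; rewrite lerDr.
case: (ex_minnP ex) => -[|a] ha min.
  (* A least exponent 0 is replaced by 1, since the curves need positive exponents to stay in the
     open disk. *)
  exists 1%N; split=> //; rewrite expr1 ler_norml; move: ha; rewrite expr0; lra.
exists a.+1; split=> //.
have : x + (1 - rho) < rho ^+ a.
  by rewrite ltNge; apply/negP => /min; rewrite ltnn.
move: ha; rewrite exprS ler_norml; move: (rho ^+ a) => p; nra.
Qed.

Lemma polar z : exists s, `|s| = 1 /\ z = s * `|z|.
Proof.
have [->|z0] := eqVneq z 0; first by exists 1; rewrite !normr0 normr1 mulr0.
have nz : `|z| != 0 by rewrite normr_eq0.
by exists (z / `|z|); rewrite normf_div normr_id divff // divfK.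
Qed.

Lemma normc_real z : exists2 r : R, `|z| = (r%:C)%C & 0 <= r.
Proof.
by exists (complex.Re `|z|); [rewrite normc_def|rewrite normc_def /= sqrtr_ge0].
Qed.

(** One [rho] serves all coordinates, so three such approximations place a curve point near any
    point of the closed polydisk. The final bound later controls the Schwarz factor. *)
Lemma disk_point_approx (rho : R) z : 0 < rho < 1 -> `|z| <= 1 ->
  exists s (a : nat), [/\ `|s| = 1, (0 < a)%N,
    `|s * (rho%:C)%C ^+ a - z| <= ((1 - rho)%:C)%C &
    (rho%:C)%C ^+ a <= `|z| + ((1 - rho)%:C)%C].
Proof.
move=> rho01 z1; have [s [s1 zE]] := polar z.
have [r rE r0] := normc_real z.
have r1 : r <= 1 by rewrite -lecR -rE.
have [a [a0 ha]] := pow_approx rho01 (introT andP (conj r0 r1)).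
exists s, a; split=> //.
  rewrite {1}zE -mulrBr normrM s1 mul1r rE -rmorphXn -rmorphB normc_def /=.
  by rewrite expr0n addr0 sqrtr_sqr lecR.
rewrite rE -rmorphXn -rmorphD lecR; move: ha; rewrite ler_norml; lra.
Qed.

End Contractive.

(** * The Schwarz lemma on the polydisk *)

Section Schwarz.
Variables (R : realType) (m n : nat).
Local Notation C := (R[i]).
Local Notation mat := 'M[C]_(m.+1, n.+1).
Implicit Types (x y z w s l : C).

Definition zero_free (P1 P2 : mat) := forall z1 z2 z3 : C,
  inD z1 -> inD z2 -> inD z3 -> peval P1 P2 z1 z2 z3 != 0.

Lemma inD0 : inD (0 : C).
Proof. by rewrite /inD normr0 ltr01. Qed.

Lemma inD_circle s w a : `|s| = 1 -> `|w| < 1 -> (0 < a)%N -> inD (s * w ^+ a).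
Proof. by move=> s1 w1 a0; rewrite /inD normrM s1 mul1r normrX exprn_ilt1 // -lt0n. Qed.

Lemma ev2_00 (M : mat) : ev2 M 0 0 = M ord0 ord0.
Proof.
rewrite /ev2 big_ord_recl big_ord_recl !expr0 !mulr1 !big1 ?addr0 //.
  by move=> i _; rewrite big1 // => j _; rewrite expr0n mulr0 mul0r.
by move=> j _; rewrite [0 ^+ _]expr0n /= mulr0.
Qed.

(** Once the constant term is absent, each remaining exponent [a * i + b * j] is at least [a] or at
    least [b]. *)
Lemma slice_divisible e (M : mat) s1 s2 a b : M ord0 ord0 = 0 ->
  (e <= a)%N -> (e <= b)%N -> exists h, slice M s1 s2 a b = 'X^e * h.
Proof.
move=> M0 ea eb; rewrite /slice.
pose dv (p : {poly C}) := exists h, p = 'X^e * h.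
have dv0 : dv 0 by exists 0; rewrite mulr0.
have dvD p q : dv p -> dv q -> dv (p + q).
  by move=> [h ->] [k ->]; exists (h + k); rewrite mulrDr.
apply: (big_ind dv) => // i _; apply: (big_ind dv) => // j _.
have [/eqP|k0] := eqVneq (a * i + b * j)%N 0%N.
  rewrite addn_eq0 !muln_eq0; have [e0 _|e0] := posnP e.
    by exists ((M i j * s1 ^+ i * s2 ^+ j) *: 'X^(a * i + b * j)); rewrite e0 mul1r.
  rewrite !eqn0Ngt (leq_trans e0 ea) (leq_trans e0 eb) /= -!eqn0Ngt.
  move=> /andP[/eqP i0 /eqP j0].
  have -> : i = ord0 by apply: val_inj.
  have -> : j = ord0 by apply: val_inj.
  by rewrite M0 !mul0r scale0r.
exists ((M i j * s1 ^+ i * s2 ^+ j) *: 'X^(a * i + b * j - e)).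
rewrite -scalerAr -exprD subnKC //.
have [j0|j0] := posnP j; last first.
  by rewrite (leq_trans eb) // (leq_trans (leq_pmulr b j0)) // leq_addl.
have [i0|i0] := posnP i; first by move: k0; rewrite i0 j0 !muln0.
by rewrite (leq_trans ea) // (leq_trans (leq_pmulr a i0)) // leq_addr.
Qed.

Lemma rslice3_divisible e (P1 P2 : mat) s1 s2 s3 a b c : ptilde P1 P2 0 0 0 = 0 ->
  (e <= a)%N -> (e <= b)%N -> (e <= c)%N ->
  exists h, rslice3 P1 P2 s1 s2 s3 a b c = 'X^e * h.
Proof.
rewrite /ptilde mul0r add0r ev2_00 => M0 ea eb ec.
have [h hE] := slice_divisible s1 s2 M0 ea eb.
exists (s3 *: 'X^(c - e) * slice (refl P1) s1 s2 a b + h).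
by rewrite /rslice3 hE mulrDr mulrA -scalerAr -exprD subnKC.
Qed.

Lemma slice3_neq0 (P1 P2 : mat) s1 s2 s3 : zero_free P1 P2 ->
  forall a b c, `|s1| = 1 -> `|s2| = 1 -> `|s3| = 1 ->
  (0 < a)%N -> (0 < b)%N -> (0 < c)%N -> forall w, `|w| < 1 -> (slice3 P1 P2 s1 s2 s3 a b c).[w] != 0.
Proof. by move=> zf a b c *; rewrite slice3E zf //; apply: inD_circle. Qed.

Lemma ptilde_le_slice e (P1 P2 : mat) s1 s2 s3 a b c w : zero_free P1 P2 ->
  `|s1| = 1 -> `|s2| = 1 -> `|s3| = 1 -> (0 < a)%N -> (0 < b)%N -> (0 < c)%N ->
  (exists h, rslice3 P1 P2 s1 s2 s3 a b c = 'X^e * h) -> `|w| < 1 ->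
  `|ptilde P1 P2 (s1 * w ^+ a) (s2 * w ^+ b) (s3 * w ^+ c)| <=
  `|w| ^+ e * `|peval P1 P2 (s1 * w ^+ a) (s2 * w ^+ b) (s3 * w ^+ c)|.
Proof.
move=> zf s11 s21 s31 a0 b0 c0 [h hE] w1; rewrite -slice3E -rslice3E.
have nz := slice3_neq0 zf s11 s21 s31 a0 b0 c0.
apply: (reflects_schwarz _ (size_slice3 _ _ _ _ _ _ _ _) _ nz _ hE w1).
- have := nz 0; rewrite normr0 ltr01 => /(_ isT); apply: contraNneq => ->.
  by rewrite horner0.
- exact: slice3_reflects.
- by rewrite !normrM !normrX s11 s21 s31 !expr1n !mulr1.
Qed.

Lemma gt0_real_part (d : C) : 0 < d -> exists2 r : R, d = (r%:C)%C & 0 < r.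
Proof.
move=> d0; have [r rE _] := normc_real d; rewrite gtr0_norm // in rE.
by exists r; rewrite // -ltcR -rE.
Qed.

Lemma limit_le (t r p : R) : 0 <= t -> 0 <= r <= 1 -> 0 <= p ->
  (forall h, 0 < h < 1 -> t - h <= (r + h) * (p + h)) -> t <= r * p.
Proof.
move=> t0 /andP[r0 r1] p0 H; rewrite leNgt; apply/negP => lt.
pose g := t - r * p; have g0 : 0 < g by rewrite /g subr_gt0.
have K0 : 0 < p + 4 + g by lra.
(* With this [h] the total error, at most [(p + 3) * h], is smaller than the gap [g]. *)
pose h := g / (p + 4 + g).
have hE : h * (p + 4 + g) = g by rewrite /h divfK // lt0r_neq0.
have h0 : 0 < h by rewrite divr_gt0.
have h1 : h < 1 by rewrite ltr_pdivrMr //; lra.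
have := H h (introT andP (conj h0 h1)).
have hp : 0 <= h * p by rewrite mulr_ge0 // ltW.
have hh : h * h <= h by rewrite ler_piMl // ltW.
have hr : h * r <= h by rewrite ler_piMr // ltW.
have hg : 0 < h * g by rewrite mulr_gt0.
have -> : (r + h) * (p + h) = r * p + h * r + h * p + h * h by ring.
have : h * p + 4 * h + h * g = g by rewrite -[RHS]hE; ring.
have gE : t = g + r * p by rewrite /g; ring.
by clearbody h g; lra.
Qed.

(** The estimate on slices passes to the limit along approximating curves. The last hypothesis
    merges two uses: contractivity for [r = 1], and the Schwarz bound when [ptilde] vanishes at the
    origin. *)
Lemma ptilde_le_radius (P1 P2 : mat) (r : R) z1 z2 z3 : zero_free P1 P2 ->
  0 <= r <= 1 -> `|z1| <= (r%:C)%C -> `|z2| <= (r%:C)%C -> `|z3| <= (r%:C)%C ->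
  ptilde P1 P2 0 0 0 = 0 \/ r = 1 ->
  `|ptilde P1 P2 z1 z2 z3| <= (r%:C)%C * `|peval P1 P2 z1 z2 z3|.
Proof.
move=> zf r01 z1r z2r z3r alt; case/andP: (r01) => r0 r1.
have [t tE t0] := normc_real (ptilde P1 P2 z1 z2 z3).
have [p pE p0] := normc_real (peval P1 P2 z1 z2 z3).
rewrite tE pE -rmorphM lecR; apply: limit_le => // h /andP[h0 h1].
have hC0 : 0 < (h%:C)%C :> C by rewrite ltcR.
have [d1 [d10 Ht]] := cont3_ptilde P1 P2 z1 z2 z3 hC0.
have [d2 [d20 Hp]] := cont3_peval P1 P2 z1 z2 z3 hC0.
have [d [/gt0_real_part[d' -> d'0] dd1 dd2]] := common_bound d10 d20.
move: dd1 dd2 => dd1 dd2.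
(* The approximation error must be below [d'] for continuity and at most [h] for the bound on the
   power. *)
pose eta := Num.min h (d' / 2).
have eta0 : 0 < eta by rewrite lt_min h0 divr_gt0.
have etah : eta <= h by rewrite ge_min lexx.
have etad : eta < d' by rewrite gt_min ltr_pdivrMr // ltr_pMr // ltr1n orbT.
pose rho := 1 - eta.
have rho01 : 0 < rho < 1 by rewrite /rho; lra.
have rC1 : (r%:C)%C <= 1 :> C by rewrite -(lecR r 1) in r1.
have [s1 [a [s11 a0 ap1 ab1]]] := disk_point_approx rho01 (le_trans z1r rC1).
have [s2 [b [s21 b0 ap2 ab2]]] := disk_point_approx rho01 (le_trans z2r rC1).
have [s3 [c [s31 c0 ap3 ab3]]] := disk_point_approx rho01 (le_trans z3r rC1).
have close (u v : C) : `|u - v| <= ((1 - rho)%:C)%C -> `|u - v| < (d'%:C)%C.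
  by move=> /le_lt_trans; apply; rewrite ltcR /rho opprB addrCA subrr addr0.
have w1 : `|(rho%:C)%C : C| < 1.
  by rewrite normc_def /= expr0n addr0 sqrtr_sqr ltcR ger0_norm; case/andP: rho01 => // /ltW.
have wE : `|(rho%:C)%C : C| = (rho%:C)%C.
  by rewrite ger0_norm // lecR; case/andP: rho01 => /ltW.
(* In the Schwarz case [e] is the least of the three exponents, and the coordinate that attains it
   gives the bound. *)
have [e he hrho] : exists2 e, exists h, rslice3 P1 P2 s1 s2 s3 a b c = 'X^e * h &
    rho ^+ e <= r + h.
  case: alt => [z0|r_1]; last first.
    exists 0%N; first by exists (rslice3 P1 P2 s1 s2 s3 a b c); rewrite mul1r.
    by rewrite expr0 r_1 lerDl ltW.
  exists (minn a (minn b c)).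
    by apply: rslice3_divisible => //; rewrite !geq_min leqnn ?orbT.
  have bd k (z : C) : (rho%:C)%C ^+ k <= `|z| + ((1 - rho)%:C)%C -> `|z| <= (r%:C)%C ->
      rho ^+ k <= r + h.
    move=> k1 zr; have := le_trans k1 (lerD zr (lexx _)).
    by rewrite -rmorphXn -rmorphD lecR /rho; lra.
  rewrite /minn; case: ifP => _; first exact: bd ab1 z1r.
  by case: ifP => _; [exact: bd ab2 z2r|exact: bd ab3 z3r].
have main := ptilde_le_slice zf s11 s21 s31 a0 b0 c0 he w1.
have Ht' := Ht _ _ _ (lt_le_trans (close _ _ ap1) dd1) (lt_le_trans (close _ _ ap2) dd1)
  (lt_le_trans (close _ _ ap3) dd1).
have Hp' := Hp _ _ _ (lt_le_trans (close _ _ ap1) dd2) (lt_le_trans (close _ _ ap2) dd2)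
  (lt_le_trans (close _ _ ap3) dd2).
rewrite -lecR rmorphB rmorphM !rmorphD /= -tE -pE.
apply: (@le_trans _ _ `|ptilde P1 P2 (s1 * (rho%:C)%C ^+ a) (s2 * (rho%:C)%C ^+ b)
    (s3 * (rho%:C)%C ^+ c)|).
  rewrite lerBlDr -lerBlDl; apply: le_trans (ltW Ht'); rewrite distrC.
  exact: lerB_dist.
apply: le_trans main _; rewrite wE ler_pM ?exprn_ge0 ?normr_ge0 //.
- by rewrite lecR; case/andP: rho01 => /ltW.
- by rewrite -rmorphXn -rmorphD lecR.
- by rewrite -lerBlDl; apply: le_trans (ltW Hp'); apply: lerB_dist.
Qed.

End Schwarz.

(** * Boundary behaviour of quotients *)

Section Quotients.
Variable R : realType.
Local Notation C := (R[i]).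
Implicit Types (A B f g : {poly C}) (x y z w s l : C).

Lemma poly_cont f x (e : C) : 0 < e -> exists d : C, 0 < d /\
  forall y, `|y - x| < d -> `|f.[y] - f.[x]| < e.
Proof.
move=> e0; have cf : cont3 (fun x (_ _ : C) => f.[x]).
  have -> : (fun x (_ _ : C) => f.[x]) =
      (fun x _ _ => \sum_(i < size f) f`_i * x ^+ i).
    by apply/funext=> a; apply/funext=> b; apply/funext=> c; rewrite horner_coef.
  apply: (cont3_sum (F := fun i x _ _ => f`_i * x ^+ i)) => i.
  exact: (cont3_mul (@cont3_cst _ f`_i) (cont3_exp i (@cont3_1 _))).
have [d [d0 H]] := cf x 0 0 _ e0; exists d; split=> // y xy.
by apply: (H y 0 0); rewrite ?subrr ?normr0.
Qed.

Lemma poly_div_cont A B x (e : R) : B.[x] != 0 -> 0 < e ->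
  exists d : R, 0 < d /\ forall y, `|y - x| < (d%:C)%C ->
    B.[y] != 0 /\ `|A.[y] / B.[y] - A.[x] / B.[x]| < (e%:C)%C.
Proof.
move=> B0 e0; have eC : 0 < (e%:C)%C :> C by rewrite ltcR.
have b0 : 0 < `|B.[x]| by rewrite normr_gt0.
have b2 : 0 < `|B.[x]| / 2 by rewrite divr_gt0.
pose E := B.[x] *: A - A.[x] *: B.
have [d1 [d10 H1]] := poly_cont E x (mulr_gt0 eC (mulr_gt0 b2 b0)).
have [d2 [d20 H2]] := poly_cont B x b2.
have [d [/gt0_real_part[r -> r0] dd1 dd2]] := common_bound d10 d20.
exists r; split=> // y xy.
have {}H1 := H1 y (lt_le_trans xy dd1); have {}H2 := H2 y (lt_le_trans xy dd2).
have bY : `|B.[x]| / 2 < `|B.[y]|.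
  have := le_lt_trans (lerB_dist B.[x] B.[y]) (_ : `|B.[x] - B.[y]| < `|B.[x]| / 2).
  by rewrite distrC => /(_ H2); rewrite ltrBlDr {1}[`|B.[x]|]splitr ltrD2l.
have By : B.[y] != 0 by rewrite -normr_gt0 (lt_trans b2).
split=> //; have -> : A.[y] / B.[y] - A.[x] / B.[x] = (E.[y] - E.[x]) / (B.[y] * B.[x]).
  by rewrite /E !(hornerD, hornerN, hornerZ); field; rewrite B0.
rewrite normf_div normrM ltr_pdivrMr ?mulr_gt0 ?normr_gt0 //.
by apply: lt_trans H1 _; rewrite ltr_pM2l // ltr_pM2r.
Qed.

Lemma cdiff_quotient (h : C -> C) A B x : (forall y, h y = A.[y] / B.[y]) ->
  B.[x] != 0 -> cdiff h x.
Proof.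
move=> hE B0.
pose sh (p : {poly C}) := p \Po ('X + x%:P).
have shE p y : (sh p).[y] = p.[x + y].
  by rewrite horner_comp hornerD hornerX hornerC addrC.
(* The numerator of [h (x + k) - h x] vanishes at [k = 0]; its cofactor [Q] turns the difference
   quotient into a quotient of polynomials continuous at 0. *)
have : root (B.[x] *: sh A - A.[x] *: sh B) 0.
  rewrite rootE !(hornerD, hornerN, hornerZ) !shE addr0.
  by rewrite mulrC subrr.
move=> /factor_theorem [Q]; rewrite subr0 => QE.
pose D := B.[x] *: sh B.
have D0 : D.[0] != 0 by rewrite hornerZ shE addr0 mulf_neq0.
exists (Q.[0] / D.[0]) => e e0.
have [d [d0 H]] := poly_div_cont Q D0 e0; exists d; split=> // k k0 kd.
have := H k; rewrite subr0 => /(_ kd)[Dk]; congr (`|_ - _| < _).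
move: Dk; rewrite /D hornerZ shE mulf_eq0 negb_or => /andP[_ Bk].
rewrite !hE; have := congr1 (fun p => p.[k]) QE.
rewrite hornerM hornerX !(hornerD, hornerN, hornerZ) !shE => Qk.
have -> : Q.[k] = (B.[x] * A.[x + k] - A.[x] * B.[x + k]) / k by rewrite Qk mulfK.
by field; rewrite B0 Bk k0.
Qed.

(** Roots at 1 cancel, as [1 - w = - (w - 1)], and for the others [|1 - a^*| = |1 - a|]. So [g / f]
    extends to 1 with the unimodular value [A.[1] / B.[1]]. *)
Lemma reflects_boundary k N f g : f != 0 -> (size f <= N.+1)%N ->
  reflects k N f g -> (forall w, `|w| < 1 -> f.[w] != 0) -> `|k| = 1 ->
  exists A B, [/\ B.[1] != 0, `|A.[1]| = `|B.[1]| &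
    forall w, g.[w] * B.[w] = A.[w] * f.[w]].
Proof.
move=> f0 sf fg fD k1; have [rs [_ _ fE gE]] := reflects_roots f0 sf fg fD.
have lc0 : lead_coef f != 0 by rewrite lead_coef_eq0.
have [A [B [B1 AB1 H]]] : exists A B, [/\ B.[1] != 0, `|A.[1]| = `|B.[1]| &
    forall w, \prod_(a <- rs) (1 - a^* * w) * B.[w] = A.[w] * \prod_(a <- rs) (w - a)].
  elim: rs {fE gE} => [|a rs [A [B [B1 AB1 H]]]].
    by exists 1, 1; split=> [||w]; rewrite ?hornerC ?oner_eq0 // !big_nil.
  have [->|a1] := eqVneq a 1.
    exists (- A), B; split=> // [|w]; first by rewrite hornerN normrN.
    by rewrite !big_cons hornerN mulrAC -mulrA [X in _ * X]mulrC H rmorph1; ring.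
  exists ((1 - a^* *: 'X) * A), (('X - a%:P) * B); split=> [||w].
  - by rewrite hornerM mulf_neq0 // hornerD hornerN hornerX hornerC subr_eq0 eq_sym.
  - rewrite !hornerM !normrM AB1; congr (_ * _).
    rewrite !(hornerD, hornerN, hornerZ, hornerX, hornerC) mulr1.
    by rewrite -[in RHS]norm_conjC rmorphB rmorph1.
  - rewrite !big_cons !hornerM !(hornerD, hornerN, hornerZ, hornerX, hornerC).
    rewrite -mulrA [_ * (_ * B.[w])]mulrCA H; ring.
exists ((k * (lead_coef f)^*) *: 'X^(N - size rs) * A), (lead_coef f *: B).
split=> [||w].
- by rewrite hornerZ mulf_neq0.
- rewrite !(hornerM, hornerZ, hornerXn) expr1n mulr1 !normrM k1 AB1 mul1r.
  by rewrite norm_conjC.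
- rewrite fE gE !(hornerM, hornerZ, hornerXn).
  transitivity (k * (lead_coef f)^* * w ^+ (N - size rs) * lead_coef f *
    (\prod_(a <- rs) (1 - a^* * w) * B.[w])); first by ring.
  by rewrite H; ring.
Qed.

Lemma norm_expi (t : R) : `|expi t| = 1.
Proof. by rewrite normc_def /= cos2Dsin2 sqrtr1. Qed.

End Quotients.

(** * The level set *)

Section LevelSet.
Variables (R : realType) (m n : nat) (P1 P2 : 'M[R[i]]_(m.+1, n.+1)).
Local Notation C := (R[i]).
Implicit Types (x y z w s t l : C).
Hypothesis irr : irreducible3 (peval P1 P2).
Hypothesis p_neq0 : zero_free P1 P2.
Hypothesis cop : ~ common_factor3 (peval P1 P2) (ptilde P1 P2).

Lemma ptilde_le z1 z2 z3 : inD z1 -> inD z2 -> inD z3 ->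
  `|ptilde P1 P2 z1 z2 z3| <= `|peval P1 P2 z1 z2 z3|.
Proof.
move=> d1 d2 d3; rewrite -[leRHS]mul1r.
by apply: ptilde_le_radius => //; rewrite ?ler01 ?lexx //; [exact: ltW..|right].
Qed.

Lemma slice3_poly_neq0 s1 s2 s3 : `|s1| = 1 -> `|s2| = 1 -> `|s3| = 1 ->
  slice3 P1 P2 s1 s2 s3 1 1 1 != 0.
Proof.
move=> s11 s21 s31; apply/eqP => e.
have w0 : `|0 : C| < 1 by rewrite normr0 ltr01.
have := slice3_neq0 p_neq0 s11 s21 s31 (ltn0Sn 0) (ltn0Sn 0) (ltn0Sn 0) w0.
by rewrite e horner0 eqxx.
Qed.

Lemma slice3_root_circle s1 s2 s3 l w : `|s1| = 1 -> `|s2| = 1 -> `|s3| = 1 ->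
  `|l| = 1 ->
  (rslice3 P1 P2 s1 s2 s3 1 1 1).[w] = l * (slice3 P1 P2 s1 s2 s3 1 1 1).[w] ->
  `|w| = 1 \/ forall z, (rslice3 P1 P2 s1 s2 s3 1 1 1).[z] =
                      l * (slice3 P1 P2 s1 s2 s3 1 1 1).[z].
Proof.
move=> s11 s21 s31 l1; apply: reflects_root_circle l1.
- exact: slice3_poly_neq0.
- exact: size_slice3.
- exact: slice3_reflects.
- exact: slice3_neq0.
- by rewrite !normrM !normrX s11 s21 s31 !expr1n !mulr1.
Qed.

(** Every line [w |-> (s1 w, s2 w, s3 w)] passes through the origin at [w = 0], so equality there
    spreads along these lines to the torus at [w = 1], and then to all points, making [ptilde] a
    multiple of [p]. *)
Lemma ptilde_neq_origin l : `|l| = 1 -> ptilde P1 P2 0 0 0 != l * peval P1 P2 0 0 0.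
Proof.
move=> l1; apply/eqP => E0.
have ET x y z : `|x| = 1 -> `|y| = 1 -> `|z| = 1 ->
    ptilde P1 P2 x y z = l * peval P1 P2 x y z.
  move=> x1 y1 z1; have [|w0|/(_ 1)] := @slice3_root_circle x y z l 0 x1 y1 z1 l1.
  - by rewrite rslice3E slice3E !expr1 !mulr0.
  - by move: w0; rewrite normr0 => /esym/eqP; rewrite oner_eq0.
  - by rewrite rslice3E slice3E !expr1 !mulr1.
have sum0 (a b c d : C) : b + a = l * (c + d) -> - b + a = l * (c - d) ->
    a = l * c /\ b = l * d.
  move=> e1 e2; split; apply: (mulfI (_ : 2 != 0 :> C)); rewrite ?pnatr_eq0 //.
    have -> : 2 * a = (b + a) + (- b + a) by ring.
    by rewrite e1 e2; ring.
  have -> : 2 * b = (b + a) - (- b + a) by ring.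
  by rewrite e1 e2; ring.
(* The values at third coordinate 1 and -1 separate the two coefficients. *)
have EC x y : `|x| = 1 -> `|y| = 1 ->
    ev2 (refl P2) x y = l * ev2 P1 x y /\ ev2 (refl P1) x y = l * ev2 P2 x y.
  move=> x1 y1; have := ET x y (-1) x1 y1; have := ET x y 1 x1 y1.
  rewrite /ptilde /peval normrN normr1 !mul1r !mulN1r => /(_ erefl) e1 /(_ erefl) e2.
  exact: sum0 e1 e2.
have scale (M P : 'M[C]_(m.+1, n.+1)) :
    (forall x y, `|x| = 1 -> `|y| = 1 -> ev2 M x y = l * ev2 P x y) ->
    forall x y, ev2 M x y = l * ev2 P x y.
  move=> H x y; have : bipoly M = l%:P%:P * bipoly P.
    by apply: bipoly_eq_circle => a b a1 b1; rewrite !hornerM !hornerC !bipolyE H.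
  by rewrite -!bipolyE => ->; rewrite !hornerM !hornerC.
apply: (ptilde_neq_scale irr cop (l := l)) => x y z.
rewrite /ptilde /peval (scale _ _ (fun x y a b => (EC x y a b).1)).
by rewrite (scale _ _ (fun x y a b => (EC x y a b).2)); ring.
Qed.

(* Composing [ptilde / p] with the disk automorphism moving its value [b] at the
   origin to [0] makes the Schwarz bound strict. *)
Lemma ptilde_neq_disk l z1 z2 z3 : `|l| = 1 -> inD z1 -> inD z2 -> inD z3 ->
  ptilde P1 P2 z1 z2 z3 != l * peval P1 P2 z1 z2 z3.
Proof.
move=> l1 d1 d2 d3; apply/eqP => E; have i0 := @inD0 R.
have p0 := p_neq0 i0 i0 i0.
pose b := ptilde P1 P2 0 0 0 / peval P1 P2 0 0 0.
have bE : ptilde P1 P2 0 0 0 = b * peval P1 P2 0 0 0 by rewrite divfK.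
have b1 : `|b| < 1.
  rewrite lt_neqAle normf_div ler_pdivrMr ?normr_gt0 // mul1r ptilde_le // andbT.
  rewrite -normf_div; apply/eqP => b1.
  by have := ptilde_neq_origin b1; rewrite -bE eqxx.
(* These are the coefficients of [p - b^* * ptilde], whose reflection is [ptilde - b * p]; the new
   quotient vanishes at the origin. *)
pose Q1 := P1 - b^* *: refl P2; pose Q2 := P2 - b^* *: refl P1.
have QE x y z : peval Q1 Q2 x y z = peval P1 P2 x y z - b^* * ptilde P1 P2 x y z.
  by rewrite /peval /ptilde /Q1 /Q2 !ev2D !ev2N !ev2Z; ring.
have QtE x y z : ptilde Q1 Q2 x y z = ptilde P1 P2 x y z - b * peval P1 P2 x y z.
  rewrite /peval /ptilde /Q1 /Q2 !reflD !reflN !reflZ !reflK conjCK.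
  by rewrite !ev2D !ev2N !ev2Z; ring.
have Qzf : zero_free Q1 Q2.
  move=> x y z xD yD zD; rewrite QE subr_eq0; apply/eqP => e.
  have : `|peval P1 P2 x y z| < `|peval P1 P2 x y z|.
    rewrite {1}e normrM norm_conjC.
    apply: le_lt_trans (ler_wpM2l (normr_ge0 _) (ptilde_le xD yD zD)) _.
    by rewrite gtr_pMl // normr_gt0 p_neq0.
  by rewrite ltxx.
have [r1 r1E r10] := normc_real z1; have [r2 r2E r20] := normc_real z2.
have [r3 r3E r30] := normc_real z3.
have lt1 (r : R) z : `|z| = (r%:C)%C -> inD z -> r < 1.
  by move=> e; rewrite /inD e -ltcR.
pose r := Num.max r1 (Num.max r2 r3).
have r_lt1 : r < 1 by rewrite /r !gt_max (lt1 _ _ r1E) ?(lt1 _ _ r2E) ?(lt1 _ _ r3E).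
have r01 : 0 <= r <= 1 by rewrite (ltW r_lt1) andbT /r le_max r10.
have : `|ptilde Q1 Q2 z1 z2 z3| <= (r%:C)%C * `|peval Q1 Q2 z1 z2 z3|.
  apply: ptilde_le_radius => //; rewrite ?r1E ?r2E ?r3E ?lecR ?le_max ?lexx ?orbT //.
  by left; rewrite QtE bE subrr.
(* For unimodular [l] one has [|l - b| = |1 - b^* * l|], so the new quotient would be unimodular
   where Schwarz bounds it by [r < 1]. *)
have -> : `|ptilde Q1 Q2 z1 z2 z3| = `|peval Q1 Q2 z1 z2 z3|.
  rewrite QE QtE E -mulrBl mulrA -{2}[peval _ _ _ _ _]mul1r -mulrBl !normrM.
  congr (_ * _); rewrite -[RHS]norm_conjC rmorphB rmorphM rmorph1 /=.
  have -> : (b^*)^* = b by exact: conjCK.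
  rewrite -[LHS]mul1r -{1}l1 -norm_conjC -normrM mulrBr [l^* * l]mulrC -normCK l1 expr1n.
  by rewrite [l^* * b]mulrC.
have Q0 : 0 < `|peval Q1 Q2 z1 z2 z3| by rewrite normr_gt0 Qzf.
by rewrite ler_pMl // lecR leNgt r_lt1.
Qed.

Lemma size_rslice3 s1 s2 s3 a b c :
  (size (rslice3 P1 P2 s1 s2 s3 a b c) <= (a * m + b * n + c).+1)%N.
Proof.
have := size_slice3 (refl P2) (refl P1) s1 s2 s3 a b c.
by rewrite /rslice3 /slice3 addrC.
Qed.

Lemma zero_in_level_closure l t1 t2 t3 :
  `|l| = 1 -> `|t1| = 1 -> `|t2| = 1 -> `|t3| = 1 ->
  ptilde P1 P2 t1 t2 t3 = l * peval P1 P2 t1 t2 t3 ->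
  level_closure P1 P2 l t1 t2 t3.
Proof.
move=> l1 t11 t21 t31 Ft eps eps0.
have e0 : 0 < (eps%:C)%C :> C by rewrite ltcR.
move: (eps%:C)%C e0 => e e0.
have level x y z : peval P1 P2 x y z != 0 ->
    ptilde P1 P2 x y z = l * peval P1 P2 x y z ->
    ptilde P1 P2 x y z / peval P1 P2 x y z = l.
  by move=> nz ->; rewrite mulfK.
pose Gs s1 s2 s3 := rslice3 P1 P2 s1 s2 s3 1 1 1 - l *: slice3 P1 P2 s1 s2 s3 1 1 1.
pose F x y z := ptilde P1 P2 x y z + (- l) * peval P1 P2 x y z.
have GsE s1 s2 s3 w : (Gs s1 s2 s3).[w] = F (s1 * w) (s2 * w) (s3 * w).
  by rewrite hornerD hornerN hornerZ rslice3E slice3E !expr1 /F mulNr.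
have F0 x y z : F x y z = 0 -> ptilde P1 P2 x y z = l * peval P1 P2 x y z.
  by rewrite /F mulNr => /eqP; rewrite subr_eq0 => /eqP.
have cF : cont3 F.
  apply: (cont3_add (cont3_ptilde P1 P2)).
  exact: (cont3_mul (@cont3_cst _ (- l)) (cont3_peval P1 P2)).
(* If the whole line through [t] solves the equation, move along it to a nearby point where [p] is
   nonzero. *)
have [G0|G0] := eqVneq (Gs t1 t2 t3) 0.
  have [s [s1 se]] := poly_neq0_near (slice3_poly_neq0 t11 t21 t31) (normr1 C) e0.
  rewrite slice3E !expr1 => ps.
  exists (t1 * s), (t2 * s), (t3 * s); split => //.
  - by rewrite /onT !normrM s1 t11 t21 t31 !mulr1.
  - by apply: level => //; apply: F0; rewrite -GsE G0 horner0.
  - have close t : `|t| = 1 -> `|t - t * s| < e.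
      by move=> tt; rewrite -{1}[t]mulr1 -mulrBr normrM tt mul1r distrC.
    by rewrite !close.
have e2 : 0 < e / 2 by rewrite divr_gt0.
(* A nearby point of the line where the equation fails supplies the lower bound in
   [root_near_one]. *)
have [u [u1 ue Gu]] := poly_neq0_near G0 (normr1 C) e2.
rewrite GsE in Gu.
pose N := (1 * m + 1 * n + 1)%N.
have k0 : 0 < `|F (t1 * u) (t2 * u) (t3 * u)| / 2.
  by rewrite divr_gt0 // normr_gt0.
set kk := `|F (t1 * u) (t2 * u) (t3 * u)| / 2 in k0.
have N0 : 0 < 2 ^+ N :> C by rewrite exprn_gt0.
(* [da] keeps the value at parameter 1 below [kk / 2 ^+ N], and [db] keeps the value at [u] above
   [kk]. *)
have [da [da0 Ha]] := cF t1 t2 t3 _ (divr_gt0 k0 N0).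
have [db [db0 Hb]] := cF (t1 * u) (t2 * u) (t3 * u) _ k0.
have [dc [dc0 dca dcb]] := common_bound da0 db0.
have [d [d0 ddc de2]] := common_bound dc0 e2.
have da_ := le_trans ddc dca; have db_ := le_trans ddc dcb.
have [c1 [c2 [c10 c20 Hc]]] := coefficients_zeros_finite irr cop.
(* Perturbing the first coordinate makes the determinant not identically zero along the line and
   removes common torus zeros of [P1] and [P2] from it. *)
have [s1 [s11 st1 [w0 Dw0] nocommon]] :=
  generic_direction (discriminant_neq0 irr p_neq0 cop) c10 c20 t11 t21 d0.
have [Dp DpE] := bipoly_slice
  (bipoly P1 * bipoly (refl P1) - bipoly P2 * bipoly (refl P2)) s1 t2.
have Dp0 : Dp != 0 by apply: contraNneq Dw0 => z; rewrite -DpE z horner0.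
have [rs rsP] := poly_roots Dp0.
(* [s3] is chosen last, so that [p] is nonzero at the finitely many zeros of the determinant on the
   circle. *)
have [|s3 [s31 st3 Hs3]] := @generic_third _ rs (fun w => ev2 P1 (s1 * w) (t2 * w))
    (fun w => ev2 P2 (s1 * w) (t2 * w)) t3 d _ t31 d0.
  move=> w w1; have w0' : w != 0 by rewrite -normr_eq0 w1 oner_eq0.
  have [z1|] := eqVneq (ev2 P1 (s1 * w) (t2 * w)) 0; last by left.
  right; apply/eqP => z2; apply: (nocommon w w0').
  by apply: Hc; rewrite ?normrM ?s11 ?t21 ?w1 ?mulr1.
have st2 : `|t2 - t2| < d by rewrite subrr normr0.
have Fs : `|F s1 t2 s3| < kk / 2 ^+ N.
  have := Ha _ _ _ (lt_le_trans st1 da_) (lt_le_trans st2 da_) (lt_le_trans st3 da_).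
  by rewrite [F t1 t2 t3](_ : _ = 0) ?subr0 // /F Ft mulNr subrr.
have Fsu : kk < `|F (s1 * u) (t2 * u) (s3 * u)|.
  have su (s t : C) : `|s - t| < d -> `|s * u - t * u| < db.
    by move=> st; rewrite -mulrBl normrM u1 mulr1; apply: lt_le_trans st db_.
  have := Hb _ _ _ (su _ _ st1) (su _ _ st2) (su _ _ st3); rewrite distrC.
  move=> /(le_lt_trans (lerB_dist _ _)); rewrite ltrBlDl -ltrBlDr.
  by rewrite {1}[`|F (t1 * u) _ _|]splitr addrK.
have szG : (size (Gs s1 t2 s3) <= N.+1)%N.
  apply: (leq_trans (size_polyD _ _)); rewrite geq_max size_rslice3 /= size_polyN.
  by apply: (leq_trans (size_scale_leq _ _)); exact: size_slice3.
have [|w Gw we] := root_near_one szG e2 (ltW ue).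
  rewrite !GsE !mulr1; apply: lt_trans Fsu.
  by rewrite mulrC -ltr_pdivlMr.
rewrite GsE in Gw.
(* Otherwise the equation would hold along the whole line, against its failure at [u]. *)
have w1 : `|w| = 1.
  have [||H] := @slice3_root_circle s1 t2 s3 l w s11 t21 s31 l1;
    rewrite ?rslice3E ?slice3E ?expr1 //.
    exact: F0.
  have := H u; rewrite rslice3E slice3E !expr1 => Hu; move: Fsu.
  by rewrite /F Hu mulNr subrr normr0 => /(lt_trans k0); rewrite ltxx.
have Fw := F0 _ _ _ Gw.
(* If [p] vanished, so would [ptilde], and eliminating the third coordinate puts [w] among the zeros
   excluded by [s3]. *)
have pw : peval P1 P2 (s1 * w) (t2 * w) (s3 * w) != 0.
  apply/eqP => pw0; have pt0 := Fw; rewrite pw0 mulr0 in pt0.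
  have wrs : w \in rs.
    apply: rsP; rewrite DpE !(hornerD, hornerN, hornerM) !bipolyE.
    move: pw0 pt0; rewrite /peval /ptilde => /eqP; rewrite addr_eq0 => /eqP ->.
    move=> /eqP; rewrite addrC addr_eq0 => /eqP ->; ring.
  have := Hs3 w wrs w1.
  by rewrite -[_ + _]/(peval P1 P2 (s1 * w) (t2 * w) (s3 * w)) pw0 eqxx.
exists (s1 * w), (t2 * w), (s3 * w); split => //.
- by rewrite /onT !normrM w1 s11 t21 s31 !mulr1.
- exact: level.
- have close (s t : C) : `|s| = 1 -> `|s - t| < d -> `|t - s * w| < e.
    move=> ss st; have -> : t - s * w = (t - s) + s * (1 - w) by ring.
    apply: le_lt_trans (ler_normD _ _) _;
    rewrite normrM ss mul1r distrC [`|1 - w|]distrC.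
    by rewrite [e]splitr ltrD // (lt_le_trans st).
  by rewrite !close.
Qed.

End LevelSet.

(** * The rational inner function [1 / Psi] *)

Section TwoVariables.
Variables (R : realType) (m n : nat).
Local Notation C := (R[i]).
Implicit Types (x y z w s t l : C).

Lemma cdiff_scale_quotient (N D : 'M[C]_(m.+1, n.+1)) l x y : l * ev2 D x y != 0 ->
  cdiff (fun w => ev2 N w y / (l * ev2 D w y)) x /\
  cdiff (fun w => ev2 N x w / (l * ev2 D x w)) y.
Proof.
move=> D0; split.
  apply: (@cdiff_quotient _ _ (bipoly N).[y%:P] (l *: (bipoly D).[y%:P])).
    by move=> w; rewrite hornerZ !bipolyE.
  by rewrite hornerZ bipolyE.
apply: (@cdiff_quotient _ _ (fiber x (bipoly N)) (l *: fiber x (bipoly D))).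
  by move=> w; rewrite hornerZ !fiberE !bipolyE.
by rewrite hornerZ fiberE bipolyE.
Qed.

(* The radial limit exists and is unimodular at every point of the torus: along
   the radius the quotient is a finite Blaschke product. *)
Lemma zero_free_RIF2 (q : 'M[C]_(m.+1, n.+1)) l : `|l| = 1 ->
  (forall x y, inD x -> inD y -> ev2 q x y != 0) ->
  RIF2 (ev2 (refl q)) (fun x y => l^* * ev2 q x y).
Proof.
move=> l1 q0; have l0 : l != 0 by rewrite -normr_eq0 l1 oner_eq0.
have lc0 : l^* != 0 by rewrite conjC_eq0.
have lq0 x y : inD x -> inD y -> l^* * ev2 q x y != 0.
  by move=> xD yD; rewrite mulf_neq0 ?q0.
split; first by exists 0, 0; apply: lq0; exact: inD0.
exists (fun x y => ev2 (refl q) x y / (l^* * ev2 q x y)); split=> //.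
  by split=> x y xD yD; [exact: (cdiff_scale_quotient _ (lq0 x y xD yD)).1|
                         exact: (cdiff_scale_quotient _ (lq0 x y xD yD)).2].
apply: (@negligibleS _ _ _ _ classical_sets.set0); last exact: negligible_set0.
move=> [a b] /=; apply.
have s11 := norm_expi a; have s21 := norm_expi b.
move: (expi a) (expi b) s11 s21 => s1 s2 s11 s21.
pose f := slice q s1 s2 1 1; pose g := slice (refl q) s1 s2 1 1.
have fD w : `|w| < 1 -> f.[w] != 0.
  by move=> w1; rewrite sliceE q0 //; apply: inD_circle.
have f0 : f != 0.
  have := fD 0; rewrite normr0 ltr01 => /(_ isT); apply: contraNneq => ->.
  by rewrite horner0.
have k1 : `|s1 ^+ m * s2 ^+ n| = 1 by rewrite normrM !normrX s11 s21 !expr1n mulr1.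
have [A [B [B1 AB1 H]]] := reflects_boundary f0 (size_slice q s1 s2 1 1)
  (slice_reflects q 1 1 s11 s21) fD k1.
have lB1 : (l^* *: B).[1] != 0 by rewrite hornerZ mulf_neq0.
exists (A.[1] / (l^* *: B).[1]); split.
  rewrite /onT hornerZ normf_div normrM norm_conjC l1 mul1r AB1 divff //.
  by rewrite normr_eq0.
move=> eps eps0; have [d [d0 Hd]] := poly_div_cont A lB1 eps0.
exists d; split=> // r r0 rd r1.
have rn : `|(r%:C)%C : C| < 1 by rewrite ger0_norm ?lecR // ltcR.
have [|By] := Hd (r%:C)%C.
  rewrite distrC ger0_norm ?subr_ge0 ?(lecR r 1) ?ltW //.
  by rewrite -(rmorph1 (real_complex R)) -rmorphB ltcR; lra.
(* On the radius [H] identifies the quotient with [A / (l^* *: B)], which is continuous at 1. *)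
congr (`|_ - _| < _); have := H (r%:C)%C; have := fD _ rn.
rewrite !sliceE !expr1 ![_ * s1]mulrC ![_ * s2]mulrC => fr Hr.
move: By; rewrite !hornerZ mulf_eq0 negb_or => /andP[_ By].
by apply/eqP; rewrite eqr_div ?mulf_neq0 //; apply/eqP; rewrite mulrCA -Hr; ring.
Qed.

End TwoVariables.

(** * The level equation on the closure *)

Section Closed.
Variables (R : realType) (m n : nat) (P1 P2 : 'M[R[i]]_(m.+1, n.+1)).
Local Notation C := (R[i]).

Lemma small_eq0 (x : C) : (forall e : R, 0 < e -> `|x| < (e%:C)%C) -> x = 0.
Proof.
move=> H; have [r rE] := normc_real x; rewrite le_eqVlt => /orP[/eqP r0|/H].
  by apply/eqP; rewrite -normr_eq0 rE -r0.
by rewrite rE ltxx.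
Qed.

(** Unimodularity and the equation with cleared denominator are closed conditions; the equation
    persists even at limits where [p] vanishes. *)
Lemma level_closure_zero (l t1 t2 t3 : C) : level_closure P1 P2 l t1 t2 t3 ->
  [/\ onT t1, onT t2, onT t3 & ptilde P1 P2 t1 t2 t3 = l * peval P1 P2 t1 t2 t3].
Proof.
move=> lev.
have unit_lim (t : C) :
    (forall e : R, 0 < e -> exists2 w, `|w| = 1 & `|t - w| < (e%:C)%C) ->
    onT t.
  move=> H; apply/eqP; rewrite -subr_eq0; apply/eqP; apply: small_eq0 => e /H [w w1].
  by apply: le_lt_trans; rewrite -w1; exact: ler_dist_dist.
split.
- by apply: unit_lim => e /lev [w1 [w2 [w3 [[? _] _ _ [? _]]]]]; exists w1.
- by apply: unit_lim => e /lev [w1 [w2 [w3 [[_ [? _]] _ _ [_ [? _]]]]]]; exists w2.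
- by apply: unit_lim => e /lev [w1 [w2 [w3 [[_ [_ ?]] _ _ [_ [_ ?]]]]]]; exists w3.
have cF := cont3_add (cont3_ptilde P1 P2)
  (cont3_mul (@cont3_cst _ (- l)) (cont3_peval P1 P2)).
apply/eqP; rewrite -subr_eq0 -mulNr; apply/eqP; apply: small_eq0 => e e0.
have eC : 0 < (e%:C)%C :> C by rewrite ltcR.
have [d [/gt0_real_part[r -> r0] Hd]] := cF t1 t2 t3 _ eC.
have [w1 [w2 [w3 [_ p0 lE [c1 [c2 c3]]]]]] := lev r r0.
have := Hd w1 w2 w3; rewrite ![`|w1 - _|]distrC ![`|w2 - _|]distrC ![`|w3 - _|]distrC.
have -> : ptilde P1 P2 w1 w2 w3 = l * peval P1 P2 w1 w2 w3 by rewrite -lE divfK.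
by move=> /(_ c1 c2 c3); rewrite [- l * peval P1 P2 w1 w2 w3]mulNr subrr sub0r normrN.
Qed.

End Closed.

Theorem theorem4p6 (R : realType) (m n : nat) (P1 P2 : 'M[R[i]]_(m.+1, n.+1))
    (lam : R[i]) :
  irreducible3 (peval P1 P2) ->
  (forall z1 z2 z3 : R[i], inD z1 -> inD z2 -> inD z3 -> peval P1 P2 z1 z2 z3 != 0) ->
  ~ common_factor3 (peval P1 P2) (ptilde P1 P2) ->
  ptilde_degree P1 P2 ->
  onT lam ->
  let q := lam *: P1 - refl P2 in
  (* (i) *)
  (forall t1 t2 t3 : R[i], onT t1 -> onT t2 -> onT t3 -> ev2 q t1 t2 = 0 ->
     level_closure P1 P2 lam t1 t2 t3) /\
  (* (ii) 1/Psi_lambda = qtilde / (conj lam * q) is a two-variable RIF *)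
  RIF2 (ev2 (refl q)) (fun z1 z2 => lam^* * ev2 q z1 z2) /\
  (* (ii) C_lambda minus (Z_q cap T^2) x T is the graph t3 = Psi_lambda(t1,t2) *)
  (forall t1 t2 t3 : R[i],
     (level_closure P1 P2 lam t1 t2 t3 /\
      ~ (onT t1 /\ onT t2 /\ onT t3 /\ ev2 q t1 t2 = 0)) <->
     (onT t1 /\ onT t2 /\ ev2 q t1 t2 != 0 /\
      t3 = lam^* * ev2 q t1 t2 / ev2 (refl q) t1 t2)).
Proof.
move=> irr p0 cop _ l1 q.
have l0 : lam != 0 by rewrite -normr_eq0 l1 oner_eq0.
have ll : lam * lam^* = 1 by rewrite -normCK l1 expr1n.
have qE x y : ev2 q x y = lam * ev2 P1 x y - ev2 (refl P2) x y.
  by rewrite /q ev2D ev2N ev2Z.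
have rqE x y : lam * ev2 (refl q) x y = ev2 (refl P1) x y - lam * ev2 P2 x y.
  by rewrite /q reflD reflN reflZ reflK ev2D ev2N ev2Z mulrBr mulrA ll mul1r.
have FE x y z : ptilde P1 P2 x y z - lam * peval P1 P2 x y z =
    z * (lam * ev2 (refl q) x y) - ev2 q x y.
  by rewrite rqE qE /ptilde /peval; ring.
have levelP x y z : onT x -> onT y -> onT z ->
    z * (lam * ev2 (refl q) x y) = ev2 q x y -> level_closure P1 P2 lam x y z.
  move=> x1 y1 z1 e; apply: zero_in_level_closure => //.
  by apply/eqP; rewrite -subr_eq0 FE e subrr.
split=> [x y z x1 y1 z1 q0|].
  (* [q] and its reflection vanish together on the torus, so the equation holds for every third
     coordinate. *)
  apply: levelP => //; have := norm_ev2_refl q x1 y1.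
  by rewrite q0 normr0 => /normr0_eq0 ->; rewrite !mulr0.
split.
  apply: zero_free_RIF2 => // x y xD yD; rewrite qE subr_eq0 eq_sym.
  (* Setting the third coordinate to 0 turns [ptilde != lam * p] into the nonvanishing of [q]. *)
  have := ptilde_neq_disk irr p0 cop l1 xD yD (@inD0 R).
  by rewrite /ptilde /peval !mul0r add0r addr0.
move=> x y z; split=> [[lev nz]|[x1 [y1 [q0 zE]]]].
  have [x1 y1 z1 F0] := level_closure_zero lev.
  have q0 : ev2 q x y != 0 by apply/eqP => e; apply: nz.
  have rq0 : ev2 (refl q) x y != 0 by rewrite -normr_eq0 norm_ev2_refl // normr_eq0.
  do 3!split=> //; have := FE x y z; rewrite F0 subrr => /esym/eqP.
  rewrite subr_eq0 => /eqP <-.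
  have -> : lam^* * (z * (lam * ev2 (refl q) x y)) =
    lam * lam^* * z * ev2 (refl q) x y by ring.
  by rewrite ll mul1r mulfK.
have rq0 : ev2 (refl q) x y != 0 by rewrite -normr_eq0 norm_ev2_refl // normr_eq0.
split; last by case=> _ [_ [_ e]]; move: q0; rewrite e eqxx.
apply: levelP => //.
  rewrite /onT zE normf_div normrM norm_conjC l1 mul1r norm_ev2_refl //.
  by rewrite divff // normr_eq0.
rewrite zE; transitivity (lam * lam^* * ev2 q x y); last by rewrite ll mul1r.
by field.
Qed.
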